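(* Let $A$ and $B$ be nonnegative selfadjoint linear relations in a complex Hilbert space $\mathcal H$ and let $T_A:=\mathfrak C(A)$, $T_B:=\mathfrak C(B)$ be their Cayley transforms. Then $$\mathfrak C\big(\tfrac12(A\dot+B)\big)=h(I+T_A,I+T_B)-I,$$ $$\mathfrak C\big(h(A,B)\big)=I-h(I-T_A,I-T_B).$$
   Context: A linear relation (l.r.) in $\mathcal H$ is a closed linear subspace $A=\{\{f,f'\}\}$ of $\mathcal H\oplus\mathcal H$ (bounded operators are identified with their graphs); $\operatorname{mul}A=\{f':\{0,f'\}\in A\}$; $A^{-1}=\{\{f',f\}:\{f,f'\}\in A\}$; $\lambda A=\{\{f,\lambda f'\}\}$. $A$ is selfadjoint if $A=A^*:=\{\{g,g'\}:(f',g)=(f,g')\ \forall\{f,f'\}\in A\}$, nonnegative if $(f',f)\ge0$ for all $\{f,f'\}\in A$. A nonnegative selfadjoint l.r. decomposes as $A=\mathrm{Graph}(A_o)\oplus(\{0\}\oplus\operatorname{mul}A)$ with $A_o$ a nonnegative selfadjoint operator in $\mathcal H\ominus\operatorname{mul}A$. The closed form of $A$ is $A[\varphi]=\|A_o^{1/2}\varphi\|^2$, $\varphi\in\mathcal D[A]=\operatorname{dom}A_o^{1/2}$; this gives a bijection between nonnegative selfadjoint l.r. and closed nonnegative (not necessarily densely defined) forms. The form sum $A\dot+B$ is the nonnegative selfadjoint l.r. associated with the closed form $A[\varphi]+B[\varphi]$, $\varphi\in\mathcal D[A]\cap\mathcal D[B]$. The parallel sum is $A:B:=(A^{-1}\dot+B^{-1})^{-1}$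 and the harmonic mean is $h(A,B):=2(A:B)=\big(\tfrac12(A^{-1}\dot+B^{-1})\big)^{-1}$. For bounded nonnegative operators $A,B$ this is the usual harmonic mean $2\,\operatorname{s-}\lim_{\varepsilon\downarrow0}\big((A+\varepsilon I)^{-1}+(B+\varepsilon I)^{-1}\big)^{-1}$, again a bounded nonnegative operator. Cayley transform: for a nonnegative selfadjoint l.r. $A$, $\mathfrak C(A)=-I+2(I+A)^{-1}$, a selfadjoint contraction; for a selfadjoint contraction $T$, $\mathfrak C(T)=\{\{(I+T)f,(I-T)f\}:f\in\mathcal H\}$, a nonnegative selfadjoint l.r.; these maps are mutually inverse. *)

(* Defs.v *)
From HB Require Import structures.
From mathcomp Require Import all_boot all_order all_algebra sesquilinear.
From mathcomp Require Import complex.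
From mathcomp Require Import all_classical all_reals topology normedtype.

Set Implicit Arguments.
Unset Strict Implicit.
Unset Printing Implicit Defensive.

Import Order.TTheory GRing.Theory Num.Theory.
Import numFieldNormedType.Exports.

Local Open Scope classical_set_scope.
Local Open Scope ring_scope.

(* A relation in H is a subset of H * H, the pair (f, f') standing for
   {f, f'}; a bounded operator is represented by its graph. *)

Definition linear_relation (R : realType) (H : completeNormedModType R[i])
    (A : set (H * H)) : Prop :=
  GRing.submod_closed [in A] /\ closed A.

Definition rel_dom (R : realType) (H : completeNormedModType R[i])
    (A : set (H * H)) : set H := [set f | exists f', A (f, f')].

Definition rel_mul (R : realType) (H : completeNormedModType R[i])
    (A : set (H * H)) : set H := [set f' | A (0, f')].

Definition rel_id (R : realType) (H : completeNormedModType R[i]) :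
  set (H * H) := [set p | p.2 = p.1].
Arguments rel_id {R} H.

Definition rel_inv (R : realType) (H : completeNormedModType R[i])
    (A : set (H * H)) : set (H * H) := [set p | A (p.2, p.1)].

Definition rel_scale (R : realType) (H : completeNormedModType R[i])
    (a : R[i]) (A : set (H * H)) : set (H * H) :=
  [set p | exists2 f', A (p.1, f') & p.2 = a *: f'].

Definition rel_add (R : realType) (H : completeNormedModType R[i])
    (A B : set (H * H)) : set (H * H) :=
  [set p | exists f' f'', [/\ A (p.1, f'), B (p.1, f'') & p.2 = f' + f'']].

Definition rel_comp (R : realType) (H : completeNormedModType R[i])
    (A B : set (H * H)) : set (H * H) :=
  [set p | exists2 g, B (p.1, g) & A (g, p.2)].

Definition orthogonal_compl (R : realType) (H : completeNormedModType R[i])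
    (dot : {dot H for Num.conj}) (M : set H) : set H :=
  [set f | forall m, M m -> dot f m = 0].

(* Adjoint of A regarded as a relation in the subspace K; for K = setT this
   is the adjoint A^* in H. *)
Definition adjoint_in (R : realType) (H : completeNormedModType R[i])
    (dot : {dot H for Num.conj}) (K : set H) (A : set (H * H)) :
    set (H * H) :=
  [set q | [/\ K q.1, K q.2 &
    forall p, A p -> dot p.2 q.1 = dot p.1 q.2]].

(* A is a nonnegative selfadjoint linear relation in the Hilbert space K. The
   order on R[i] makes [0 <= z] mean that z is real and nonnegative. *)
Definition nonneg_selfadjoint_in (R : realType)
    (H : completeNormedModType R[i]) (dot : {dot H for Num.conj})
    (K : set H) (A : set (H * H)) : Prop :=
  [/\ linear_relation A, A = adjoint_in dot K A &
      forall p, A p -> 0 <= dot p.2 p.1].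

Definition nonneg_selfadjoint (R : realType)
    (H : completeNormedModType R[i]) (dot : {dot H for Num.conj})
    (A : set (H * H)) : Prop :=
  nonneg_selfadjoint_in dot setT A.

(* The space H (-) mul A in which the operator part of A acts. *)
Definition oper_space (R : realType) (H : completeNormedModType R[i])
    (dot : {dot H for Num.conj}) (A : set (H * H)) : set H :=
  orthogonal_compl dot (rel_mul A).

(* A_o: the orthogonal complement of {0} (+) mul A in A. *)
Definition oper_part (R : realType) (H : completeNormedModType R[i])
    (dot : {dot H for Num.conj}) (A : set (H * H)) : set (H * H) :=
  [set p | A p /\ oper_space dot A p.2].

(* A_o^{1/2}: the nonnegative selfadjoint operator S in H (-) mul A with
   S^2 = A_o; it exists and is unique when A is a nonnegative selfadjoint
   linear relation (set0 is a junk value otherwise). *)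
Definition oper_sqrt (R : realType) (H : completeNormedModType R[i])
    (dot : {dot H for Num.conj}) (A : set (H * H)) : set (H * H) :=
  xget set0 [set S | [/\ nonneg_selfadjoint_in dot (oper_space dot A) S,
                         rel_mul S = [set 0] &
                         rel_comp S S = oper_part dot A]].

(* The value S f, for a single-valued S and f in its domain; 0 outside. *)
Definition rel_apply (R : realType) (H : completeNormedModType R[i])
    (S : set (H * H)) (f : H) : H := xget 0 [set f' | S (f, f')].

Definition form_dom (R : realType) (H : completeNormedModType R[i])
    (dot : {dot H for Num.conj}) (A : set (H * H)) : set H :=
  rel_dom (oper_sqrt dot A).

Definition form_val (R : realType) (H : completeNormedModType R[i])
    (dot : {dot H for Num.conj}) (A : set (H * H)) (f : H) : R[i] :=
  `|rel_apply (oper_sqrt dot A) f| ^+ 2.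

(* The nonnegative selfadjoint linear relation C whose closed form is
   C[f] = A[f] + B[f] on D[A] `&` D[B]; it exists and is unique when A and B
   are nonnegative selfadjoint (set0 is a junk value otherwise). *)
Definition form_sum (R : realType) (H : completeNormedModType R[i])
    (dot : {dot H for Num.conj}) (A B : set (H * H)) : set (H * H) :=
  xget set0 [set C | [/\ nonneg_selfadjoint dot C,
    form_dom dot C = form_dom dot A `&` form_dom dot B &
    forall f, form_dom dot C f ->
      form_val dot C f = form_val dot A f + form_val dot B f]].

Definition parallel_sum (R : realType) (H : completeNormedModType R[i])
    (dot : {dot H for Num.conj}) (A B : set (H * H)) : set (H * H) :=
  rel_inv (form_sum dot (rel_inv A) (rel_inv B)).

Definition harmonic_mean (R : realType) (H : completeNormedModType R[i])
    (dot : {dot H for Num.conj}) (A B : set (H * H)) : set (H * H) :=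
  rel_scale 2 (parallel_sum dot A B).

Definition cayley (R : realType) (H : completeNormedModType R[i])
    (A : set (H * H)) : set (H * H) :=
  rel_add (rel_scale (-1) (rel_id H))
          (rel_scale 2 (rel_inv (rel_add (rel_id H) A))).

(* Main.v *)
(* Each nonnegative selfadjoint relation is the relation represented by a closed
   form t on a subspace D: {f, f'} belongs to it iff f is in D and
   (f', g) = t(f, g) for all g in D. Conversely a closed form is recovered from
   its relation C because dom C is a core: minimising a quadratic functional in
   the form inner product produces the approximating sequences. Hence the form
   sum of two represented relations is represented by t1 + t2 on D1 `&` D2, and
   since the inverse of I + T_A is (I + A)/2, represented by (1 + t)/2, the
   first identity comes down to (1 + t1)/2 + (1 + t2)/2 = 1 + (t1 + t2)/2. The
   second one is the first for the inverses, as the Cayley transform of A^-1 is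
   -T_A.
   With J = (I + A)^-1, the square root defining the form of A is
   {{J^(1/2) g, (I - J)^(1/2) g} : g orthogonal to mul A}, where
   (I - T)^(1/2) = I - lim X_n with X_{n+1} = (T + X_n^2)/2 for a selfadjoint
   contraction T. *)

Require Import Defs.
From HB Require Import structures.
From mathcomp Require Import all_boot all_order all_algebra sesquilinear.
From mathcomp Require Import complex.
From mathcomp Require Import all_classical all_reals topology normedtype.
From mathcomp Require Import ring lra.

Set Implicit Arguments.
Unset Strict Implicit.
Unset Printing Implicit Defensive.

Import Order.TTheory GRing.Theory Num.Theory.
Import numFieldNormedType.Exports.

Local Open Scope classical_set_scope.
Local Open Scope ring_scope.

(** * Nonnegative sesquilinear forms *)

(** Discriminant argument along the direction [(-a, -b)]. With [e] a value of a form it gives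
    Cauchy-Schwarz; with [e] the defect of an approximate minimiser it gives the limit in
    [riesz]. *)
Lemma quadratic_ge0_bound (R : realFieldType) (e a b q : R) :
  0 <= e -> 0 <= q ->
  (forall x y : R, 0 <= e + 2 * (x * a + y * b) + (x ^+ 2 + y ^+ 2) * q) ->
  a ^+ 2 + b ^+ 2 <= e * q.
Proof.
move=> e0 q0 h; set c := a ^+ 2 + b ^+ 2.
have hr r : 0 <= e - 2 * (r * c) + r ^+ 2 * c * q.
  by have := h (- r * a) (- r * b); rewrite /c; congr (0 <= _); ring.
have c0 : 0 <= c by rewrite /c addr_ge0 ?sqr_ge0.
have [->|cn0] := eqVneq c 0; first exact: mulr_ge0.
have cp : 0 < c by rewrite lt_def cn0.
(* The parameter [e / c] used below vanishes when [e = 0]; in that case [(q + 1)^-1] makes the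
   expression in [hr] negative. *)
have [e00|en0] := eqVneq e 0.
  have q1 : 0 < q + 1 by rewrite ltr_wpDl.
  have := hr (q + 1)^-1; rewrite e00 => h1.
  have : 0 <= c * (q + 1) ^- 2 * (- 2 * (q + 1) + q).
    by move: h1; congr (0 <= _); field; rewrite gt_eqF.
  rewrite pmulr_rge0 ?mulr_gt0 ?invr_gt0 ?exprn_gt0 //.
  by nra.
have ep : 0 < e by rewrite lt_def en0.
have h1 := hr (e / c).
have : 0 <= (e / c) * (- c + e * q).
  by move: h1; congr (0 <= _); field.
by rewrite pmulr_rge0 ?divr_gt0 // addrC subr_ge0.
Qed.

Section Forms.
Variables (R : realType) (V : lmodType R[i]).
Implicit Types (E D : set V) (s t : V -> V -> R[i]) (u : nat -> V).

Definition lin_subspace E : Prop :=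
  E 0 /\ forall (a : R[i]) f g, E f -> E g -> E (a *: f + g).

Lemma lin_subspaceD E f g : lin_subspace E -> E f -> E g -> E (f + g).
Proof. by move=> [_ h] ef eg; rewrite -[f]scale1r; apply: h. Qed.

Lemma lin_subspaceZ E a f : lin_subspace E -> E f -> E (a *: f).
Proof. by move=> [h0 h] ef; rewrite -[_ *: _]addr0; apply: h. Qed.

Lemma lin_subspaceB E f g : lin_subspace E -> E f -> E g -> E (f - g).
Proof.
by move=> [_ h] ef eg; rewrite addrC -scaleN1r; apply: h.
Qed.

(** [s] is a total function whose values outside [E] are arbitrary, hence the membership hypotheses
    in all the rules below. *)
Definition form_on E s : Prop :=
  [/\ lin_subspace E,
      forall (a : R[i]) f g h, E f -> E g -> E h ->
        s (a *: f + g) h = a * s f h + s g h,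
      forall f g, E f -> E g -> s f g = conjc (s g f) &
      forall f, E f -> 0 <= s f f].

Lemma form_onDl E s f g h : form_on E s -> E f -> E g -> E h ->
  s (f + g) h = s f h + s g h.
Proof.
by move=> [_ sl _ _] ef eg eh; rewrite -[f]scale1r sl // mul1r scale1r.
Qed.

Lemma form_on0l E s h : form_on E s -> E h -> s 0 h = 0.
Proof.
move=> sE eh; have e0 : E 0 by case: sE => -[].
by apply: (addrI (s 0 h)); rewrite -(form_onDl sE) // !addr0.
Qed.

Lemma form_onZl E s a f h : form_on E s -> E f -> E h ->
  s (a *: f) h = a * s f h.
Proof.
move=> sE ef eh; have e0 : E 0 by case: sE => -[].
have [_ sl _ _] := sE.
by rewrite -[a *: f]addr0 sl // (form_on0l sE eh) !addr0.
Qed.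

Lemma form_onBl E s f g h : form_on E s -> E f -> E g -> E h ->
  s (f - g) h = s f h - s g h.
Proof.
move=> sE ef eg eh; have es : lin_subspace E by case: sE.
rewrite -scaleN1r (form_onDl sE) //; last exact: lin_subspaceZ.
by rewrite (form_onZl _ sE) // mulN1r.
Qed.

Lemma form_onC E s f g : form_on E s -> E f -> E g -> s f g = conjc (s g f).
Proof. by move=> [_ _ h _]; exact: h. Qed.

Lemma form_onDr E s f g h : form_on E s -> E f -> E g -> E h ->
  s h (f + g) = s h f + s h g.
Proof.
move=> sE ef eg eh; have es : lin_subspace E by case: sE.
rewrite (form_onC sE eh) ?(form_onDl sE) //; last exact: lin_subspaceD.
by rewrite rmorphD /= -!(form_onC sE).
Qed.

Lemma form_onZr E s a f h : form_on E s -> E f -> E h ->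
  s h (a *: f) = conjc a * s h f.
Proof.
move=> sE ef eh; have es : lin_subspace E by case: sE.
rewrite (form_onC sE eh) ?(form_onZl _ sE) //; last exact: lin_subspaceZ.
by rewrite rmorphM /= -(form_onC sE).
Qed.

(** The real part loses nothing on [E], where [s f f] is real by nonnegativity ([quadE]), and it
    moves the estimates into the ordered field [R]. *)
Definition quad s f : R := complex.Re (s f f).

Lemma quad_ge0 E s f : form_on E s -> E f -> 0 <= quad s f.
Proof. by move=> [_ _ _ h] /h; rewrite lecE => /andP[]. Qed.

Lemma quadE E s f : form_on E s -> E f -> s f f = (quad s f)%:C%C.
Proof. by move=> [_ _ _ h] /h /ger0_real /RRe_real. Qed.

(** With the scalar split into real parameters, nonnegativity of the left side is the hypothesis of
    [quadratic_ge0_bound]. The laws for sums, differences and real multiples are special cases. *)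
Lemma quad_line E s f g (x y : R) : form_on E s -> E f -> E g ->
  quad s (f + (x +i* y)%C *: g) =
  quad s f + 2 * (x * complex.Re (s f g) + y * complex.Im (s f g))
  + (x ^+ 2 + y ^+ 2) * quad s g.
Proof.
move=> sE ef eg; have es : lin_subspace E by case: sE.
have ez : E ((x +i* y)%C *: g) by exact: lin_subspaceZ.
have ed : E (f + (x +i* y)%C *: g) by exact: lin_subspaceD.
rewrite /quad (form_onDl sE) // !(form_onDr sE) //.
rewrite !(form_onZr _ sE) // !(form_onZl _ sE) //.
rewrite (form_onC sE eg ef) (quadE sE ef) (quadE sE eg).
by case: (s f g) => a b /=; ring.
Qed.

Lemma quadD E s f g : form_on E s -> E f -> E g ->
  quad s (f + g) = quad s f + 2 * complex.Re (s f g) + quad s g.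
Proof.
move=> sE ef eg; rewrite -[g in LHS]scale1r (quad_line 1 0 sE ef eg); ring.
Qed.

Lemma quadB E s f g : form_on E s -> E f -> E g ->
  quad s (f - g) = quad s f - 2 * complex.Re (s f g) + quad s g.
Proof.
move=> sE ef eg.
have -> : f - g = f + ((-1) +i* 0)%C *: g.
  by rewrite -scaleN1r; congr (_ + _ *: _); apply/eqP;
    rewrite eq_complex /= oppr0 !eqxx.
rewrite (quad_line _ _ sE ef eg); ring.
Qed.

Lemma quadZ E s (x : R) f : form_on E s -> E f ->
  quad s (x%:C%C *: f) = x ^+ 2 * quad s f.
Proof.
move=> sE ef; have [e0 _] : lin_subspace E by case: sE.
rewrite -[_ *: _]add0r (quad_line x 0 sE e0 ef) /quad !(form_on0l sE) //=.
by ring.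
Qed.

Lemma quad_distC E s f g : form_on E s -> E f -> E g ->
  quad s (f - g) = quad s (g - f).
Proof.
move=> sE ef eg; rewrite !(quadB sE) // (form_onC sE eg ef).
by case: (s f g) => a b /=; ring.
Qed.

(** The parallelogram law with the square of [(f - h) - (h - g)] dropped; the factor 2 is the price
    of working with squared seminorms. *)
Lemma quad_triangle E s f g h : form_on E s -> E f -> E g -> E h ->
  quad s (f - g) <= 2 * (quad s (f - h) + quad s (h - g)).
Proof.
move=> sE ef eg eh; have es : lin_subspace E by case: sE.
have e1 : E (f - h) by exact: lin_subspaceB.
have e2 : E (h - g) by exact: lin_subspaceB.
have := quad_ge0 sE (lin_subspaceB es e1 e2).
have -> : f - g = (f - h) + (h - g) by rewrite addrA subrK.
rewrite (quadB sE e1 e2) (quadD sE e1 e2); lra.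
Qed.

Lemma cauchy_schwarz E s f g : form_on E s -> E f -> E g ->
  complex.Re (s f g) ^+ 2 + complex.Im (s f g) ^+ 2 <= quad s f * quad s g.
Proof.
move=> sE ef eg; apply: quadratic_ge0_bound; try exact: (quad_ge0 sE).
move=> x y; rewrite -(quad_line x y sE ef eg); apply: (quad_ge0 sE).
have es : lin_subspace E by case: sE.
by apply: lin_subspaceD => //; exact: lin_subspaceZ.
Qed.

(** * Convergence and completeness in the seminorm of a form *)

Definition form_cauchy s u : Prop := forall e : R, 0 < e ->
  exists N, forall m n, (N <= m)%N -> (N <= n)%N -> quad s (u m - u n) < e.

Definition form_lim s u f : Prop := forall e : R, 0 < e ->
  exists N, forall n, (N <= n)%N -> quad s (u n - f) < e.

Definition complete_form E s : Prop := form_on E s /\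
  forall u, (forall n, E (u n)) -> form_cauchy s u ->
    exists2 f, E f & form_lim s u f.

Lemma form_lim_cauchy E s u f : form_on E s -> (forall n, E (u n)) -> E f ->
  form_lim s u f -> form_cauchy s u.
Proof.
move=> sE eu ef uf e e0; have [N hN] := uf (e / 4) ltac:(lra).
exists N => m n /hN hm /hN hn.
apply: (le_lt_trans (quad_triangle sE (eu m) (eu n) ef)).
rewrite (quad_distC sE ef (eu n)); lra.
Qed.

(** Both [s f g] and [c] are close to [s (u n) g], the former by Cauchy-Schwarz. *)
Lemma form_lim_const E s u f g c : form_on E s -> (forall n, E (u n)) -> E f ->
  E g -> form_lim s u f ->
  (forall e : R, 0 < e -> exists N, forall n, (N <= n)%N ->
    complex.Re (s (u n) g - c) ^+ 2 + complex.Im (s (u n) g - c) ^+ 2 < e) ->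
  s f g = c.
Proof.
move=> sE eu ef eg uf uc.
pose d := s f g - c.
suff : complex.Re d ^+ 2 + complex.Im d ^+ 2 <= 0.
  move=> h; have : complex.Re d = 0 /\ complex.Im d = 0 by split; nra.
  rewrite /d => -[h1 h2]; apply/eqP; rewrite -subr_eq0.
  by move: h1 h2; case: (_ - _) => a b /= -> ->.
rewrite leNgt; apply/negP => dp.
set dd := _ + _ in dp.
pose q := quad s g.
have q0 : 0 <= q := quad_ge0 sE eg.
(* With both squared distances to [s (u n) g] below [dd / 4], the squared triangle inequality gives
   [dd < dd]; [q + 1] guards against [q = 0]. *)
have [N1 h1] := uf (dd / (4 * (q + 1))) ltac:(by rewrite divr_gt0 //; nra).
have [N2 h2] := uc (dd / 4) ltac:(lra).
pose n := maxn N1 N2.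
have := h1 n (leq_maxl _ _); have := h2 n (leq_maxr _ _).
have es : lin_subspace E by case: sE.
have := cauchy_schwarz sE (lin_subspaceB es (eu n) ef) eg.
rewrite (form_onBl sE) // -/q.
rewrite /dd /d.
case: (s f g) => a1 a2; case: (s (u n) g) => b1 b2.
case: c {uc h2 d dp dd h1} => c1 c2 /=.
set w := quad _ _ => h3 h4 h5.
have w0 : 0 <= w := quad_ge0 sE (lin_subspaceB es (eu n) ef).
rewrite ltr_pdivlMr in h5; last nra.
have := sqr_ge0 (b1 - a1 + (b1 - c1)); have := sqr_ge0 (b2 - a2 + (b2 - c2)).
have : w * q <= w * (q + 1) by rewrite ler_wpM2l // lerDl.
set z := w * (q + 1) in h5 *.
have h6 : w * (4 * (q + 1)) = 4 * z by rewrite /z; ring.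
rewrite h6 in h5; set y := w * q in h3 *.
move=> h7 h8 h9.
have e1 x1 x2 x3 : (x1 - x3) ^+ 2 = 2 * (x2 - x3) ^+ 2 + 2 * (x2 - x1) ^+ 2
    - (x2 - x1 + (x2 - x3)) ^+ 2 :> R by ring.
rewrite (e1 a1 b1) (e1 a2 b2) in h5 h4; lra.
Qed.

Lemma form_lim_left E s u f g : form_on E s -> (forall n, E (u n)) -> E f ->
  E g -> form_lim s u f -> forall e : R, 0 < e ->
  exists N, forall n, (N <= n)%N -> complex.Re (s (u n) g - s f g) ^+ 2
    + complex.Im (s (u n) g - s f g) ^+ 2 < e.
Proof.
move=> sE eu ef eg uf e e0; have q0 := quad_ge0 sE eg.
have es : lin_subspace E by case: sE.
have [N hN] := uf (e / (quad s g + 1)) ltac:(by rewrite divr_gt0 // ltr_wpDl).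
exists N => n /hN; rewrite ltr_pdivlMr ?ltr_wpDl //.
rewrite -(form_onBl sE) //; apply: le_lt_trans.
apply: le_trans (cauchy_schwarz sE (lin_subspaceB es (eu n) ef) eg) _.
by rewrite ler_wpM2l ?lerDl // (quad_ge0 sE (lin_subspaceB es (eu n) ef)).
Qed.

(** Only the seminorm of [f - g] vanishes, since [s] may be degenerate. *)
Lemma form_lim_unique E s u f g : form_on E s -> (forall n, E (u n)) -> E f ->
  E g -> form_lim s u f -> form_lim s u g -> quad s (f - g) = 0.
Proof.
move=> sE eu ef eg uf ug; have es : lin_subspace E by case: sE.
apply/eqP; rewrite eq_le (quad_ge0 sE (lin_subspaceB es ef eg)) andbT.
rewrite leNgt; apply/negP => dp.
set d := quad s (f - g) in dp.
have [N1 h1] := uf (d / 4) ltac:(lra).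
have [N2 h2] := ug (d / 4) ltac:(lra).
have := h1 _ (leq_maxl N1 N2); have := h2 _ (leq_maxr N1 N2).
set n := maxn _ _ => h3 h4.
have := quad_triangle sE ef eg (eu n).
rewrite -/d (quad_distC sE ef (eu n)); lra.
Qed.

End Forms.

Lemma inv_succ_lt (R : realType) (e : R) : 0 < e ->
  exists N, forall n, (N <= n)%N -> n.+1%:R^-1 < e.
Proof.
move=> e0; have h : 0 <= e^-1 by rewrite invr_ge0 ltW.
have := archi_boundP h.
set N := Num.bound _ => hN; exists N => n Nn.
rewrite invf_plt ?posrE ?ltr0n //; apply: (lt_trans hN).
by rewrite ltr_nat.
Qed.

(* The last hypothesis bounds [quad s f - 2 Re (l f)] from below; a minimising
   sequence is Cauchy by the parallelogram law, and D need not be closed. *)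
Lemma riesz (R : realType) (V : lmodType R[i]) (E D : set V)
    (s : V -> V -> R[i]) (l : V -> R[i]) (K : R) :
  complete_form E s -> lin_subspace D -> D `<=` E ->
  (forall (a : R[i]) f g, D f -> D g -> l (a *: f + g) = conjc a * l f + l g) ->
  (forall f, D f -> 2 * complex.Re (l f) <= quad s f + K) ->
  exists u : nat -> V, exists2 phi, E phi &
  [/\ forall n, D (u n), form_lim s u phi & forall f, D f -> s phi f = l f].
Proof.
move=> [sE sc] sD DE ll lK.
have l0 : l 0 = 0.
  have [d0 _] := sD; apply: (addrI (l 0)).
  by have := ll 1 _ _ d0 d0; rewrite scale1r !addr0 rmorph1 mul1r.
have lZ a f : D f -> l (a *: f) = conjc a * l f.
  by move=> df; have [d0 _] := sD; rewrite -[_ *: _]addr0 ll // l0 addr0.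
have lD f g : D f -> D g -> l (f + g) = l f + l g.
  by move=> df dg; rewrite -[f in LHS]scale1r ll // rmorph1 mul1r.
pose F f := quad s f - 2 * complex.Re (l f).
pose X := [set F f | f in D].
have X0 : has_inf X.
  split; first by have [d0 _] := sD; exists (F 0), 0.
  by exists (- K) => _ [f df <-]; rewrite /F; have := lK _ df; lra.
have Xl f : D f -> inf X <= F f.
  by move=> df; apply: ge_inf => //; [case: X0|exists f].
have /choice[u hu] (n : nat) : exists f, D f /\ F f < inf X + n.+1%:R^-1.
  have n0 : 0 < n.+1%:R^-1 :> R by rewrite invr_gt0 ltr0n.
  have [_ [f df <-] h] := inf_adherent n0 X0.
  by exists f.
have uD n : D (u n) by case: (hu n).
have uF n : F (u n) < inf X + n.+1%:R^-1 by case: (hu n).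
have uE n : E (u n) by exact: DE.
have uC : form_cauchy s u.
  (* By the parallelogram law [quad s (u m - u n)] equals [2 F (u m) + 2 F (u n)] minus four times
     [F] at the midpoint, which is at most [2 / (m + 1) + 2 / (n + 1)]; hence [e / 4]. *)
  move=> e e0; have [N hN] := inv_succ_lt (ltac:(lra) : 0 < e / 4).
  exists N => m n /hN hm /hN hn.
  have ds : D (u m + u n) by exact: lin_subspaceD.
  have /Xl : D ((2^-1)%:C%C *: (u m + u n)) by exact: lin_subspaceZ.
  rewrite /F (quadZ _ sE (DE _ ds)) lZ // lD // (quadD sE) // (quadB sE) //.
  have := uF m; have := uF n; rewrite /F.
  move: (inf X) => d.
  case: (l (u m)) => a1 b1; case: (l (u n)) => a2 b2 /=.
  rewrite oppr0 mul0r subr0 exprVn => h1 h2 h3.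
  have h4 x : (2 ^+ 2)^-1 * x = x / 4 :> R by rewrite mulrC -natrX.
  move: hm hn h1 h2 h3; rewrite {}h4; move: m.+1%:R^-1 n.+1%:R^-1 => x y.
  lra.
have [phi ephi uphi] := sc u uE uC.
exists u, phi => //; split=> // f df.
apply: (form_lim_const sE uE ephi (DE _ df) uphi) => e e0.
have q0 := quad_ge0 sE (DE _ df).
have d0 : 0 < e / (quad s f + 1) by rewrite divr_gt0 // ltr_wpDl.
have [N hN] := inv_succ_lt d0.
exists N => n /hN; rewrite ltr_pdivlMr; last by lra.
apply: le_lt_trans.
have n0 : 0 <= n.+1%:R^-1 :> R by rewrite invr_ge0 ler0n.
apply: le_trans (_ : n.+1%:R^-1 * quad s f <= _); last first.
  by rewrite ler_wpM2l // lerDl.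
(* Moving from [u n] along [f] lowers [F] by at most [1 / (n + 1)]; this quadratic inequality bounds
   the squared modulus of [s (u n) f - l f]. *)
apply: quadratic_ge0_bound => // x y.
have dz : D ((x +i* y)%C *: f) by exact: lin_subspaceZ.
have /Xl : D (u n + (x +i* y)%C *: f) by exact: lin_subspaceD.
rewrite /F (quad_line _ _ sE) //; last exact: DE.
rewrite lD // lZ //.
have := uF n; rewrite /F.
move: (inf X) => d.
case: (l (u n)) => a1 b1; case: (l f) => a2 b2; case: (s (u n) f) => a3 b3 /=.
move: n.+1%:R^-1 => w; rewrite !mulrBr; lra.
Qed.

(** * The Hilbert space *)

Section Hilbert.
Variables (R : realType) (H : completeNormedModType R[i]).
Variable dot : {dot H for Num.conj}.
Hypothesis norm_dot : forall f : H, `|f| ^+ 2 = dot f f.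

Lemma dotC f g : dot f g = conjc (dot g f).
Proof. by rewrite hermC expr0 mul1r. Qed.

Lemma form_on_dot : form_on setT dot.
Proof.
split.
- by [].
- by move=> a f g h _ _ _; rewrite linearPl.
- by move=> f g _ _; exact: dotC.
- by move=> f _; rewrite -norm_dot exprn_ge0.
Qed.

Lemma normE (f : H) : `|f| = (complex.Re `|f|)%:C%C.
Proof. by rewrite RRe_real ?normr_real. Qed.

Lemma quad_dot f : quad dot f = complex.Re `|f| ^+ 2.
Proof. by rewrite /quad -norm_dot normE -rmorphXn. Qed.

Lemma quad_dot_eq0 f : quad dot f = 0 -> f = 0.
Proof.
rewrite quad_dot => /eqP; rewrite sqrf_eq0 => /eqP h.
by apply/eqP; rewrite -normr_eq0 normE h.
Qed.

Lemma quad_dot_lt (f : H) (e : R) : 0 <= e ->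
  (quad dot f < e ^+ 2) = (`|f| < e%:C%C).
Proof.
move=> e0; rewrite quad_dot normE ltcR ltr_sqr ?nnegrE //.
by rewrite -lecR -normE; exact: normr_ge0.
Qed.

Lemma dot_inj f g : (forall h, dot f h = dot g h) -> f = g.
Proof.
move=> h; apply/eqP; rewrite -subr_eq0; apply/eqP/quad_dot_eq0.
by rewrite /quad linearBl /= h subrr.
Qed.

Lemma form_lim_cvg (u : nat -> H) f : form_lim dot u f -> u @ \oo --> f.
Proof.
move=> uf; apply/cvgrPdist_lt => e e0.
(* The radius lives in [R[i]], where positivity entails being real. *)
have [er eE] : exists x : R, e = x%:C%C.
  by exists (complex.Re e); rewrite RRe_real // gtr0_real.
have x0 : 0 < er by rewrite -ltcR -eE.
have [N hN] := uf _ (exprn_gt0 2 x0).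
exists N => // n /= /hN.
by rewrite quad_dot_lt 1?ltW // distrC eE.
Qed.

Lemma complete_form_dot : complete_form setT dot.
Proof.
split=> [|u _ uC]; first exact: form_on_dot.
have : cauchy (u @ \oo).
  apply/cauchy_exP => e e0.
  have [er eE] : exists x : R, e = x%:C%C.
    by exists (complex.Re e); rewrite RRe_real // gtr0_real.
  have x0 : 0 < er by rewrite -ltcR -eE.
  have [N hN] := uC _ (exprn_gt0 2 x0).
  exists (u N); exists N => // n /= Nn.
  by rewrite -ball_normE /= eE -quad_dot_lt 1?ltW //; exact: hN.
move/cauchy_cvg => /cvg_ex[f /cvgrPdist_lt uf].
exists f => // e e0.
(* This gives [r ^+ 2 <= r <= e], which turns a bound on the norm into one on its square. *)
pose r : R := Num.min 1 e.
have r0 : 0 < r by rewrite lt_min ltr01.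
have [|N _ hN] := uf r%:C%C; first by rewrite ltcR.
exists N => n /hN; rewrite distrC -quad_dot_lt 1?ltW //.
move=> h; apply: (lt_le_trans h).
have [r1 re] : r <= 1 /\ r <= e by rewrite !ge_min !lexx orbT.
by apply: le_trans re; rewrite expr2 ler_piMl // ltW.
Qed.

Lemma closed_form_lim (A : set (H * H)) (u v : nat -> H) f g : closed A ->
  (forall n, A (u n, v n)) -> form_lim dot u f -> form_lim dot v g -> A (f, g).
Proof.
move=> cA hA /form_lim_cvg uf /form_lim_cvg vg.
apply: (@closed_cvg _ _ \oo _ (fun n => (u n, v n)) A cA) => //.
  by near=> n.
exact: cvg_pair.
Unshelve. all: by end_near. Qed.

(** A point of the closure is the limit of a sequence in the adjoint, and the defining identity
    passes to the limit in both components. *)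
Lemma closed_adjoint_in (K : set H) (A : set (H * H)) :
  (forall u f, (forall n, K (u n)) -> form_lim dot u f -> K f) ->
  closed (adjoint_in dot K A).
Proof.
move=> cK [f g] clfg.
have /choice[uv huv] (n : nat) : exists p : H * H, adjoint_in dot K A p /\
    (quad dot (p.1 - f) < n.+1%:R^-1 ^+ 2 /\
     quad dot (p.2 - g) < n.+1%:R^-1 ^+ 2).
  have n0 : 0 < n.+1%:R^-1 :> R by rewrite invr_gt0 ltr0n.
  have [|p [Ap [/= h1 h2]]] := clfg (ball (f, g) (n.+1%:R^-1)%:C%C).
    by apply: nbhsx_ballx; rewrite ltcR.
  exists p; split=> //.
  by rewrite !quad_dot_lt 1?ltW // (distrC p.1) (distrC p.2); move: h1 h2;
    rewrite -!ball_normE.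
have lim (w : nat -> H) h :
    (forall n, quad dot (w n - h) < n.+1%:R^-1 ^+ 2) -> form_lim dot w h.
  move=> wh e e0; have [N hN] := inv_succ_lt e0.
  exists N => n /hN h1; apply: lt_trans (wh n) _; apply: le_lt_trans h1.
  by rewrite expr2 ler_piMl ?invr_ge0 ?invf_le1 ?ler1n // ltr0n.
have lu : form_lim dot (fun n => (uv n).1) f.
  by apply: lim => n; case: (huv n) => _ [].
have lv : form_lim dot (fun n => (uv n).2) g.
  by apply: lim => n; case: (huv n) => _ [].
split=> /=; first 1 last.
- by apply: cK lv => n; case: (huv n) => -[].
- move=> p Ap; have tT n : setT (uv n).2 by [].
  (* Limits are taken in the first argument, so both sides are conjugated. *)
  rewrite dotC (dotC p.1); congr conjc.
  have lim1 := form_lim_left form_on_dot _ _ (I : setT p.1) lv.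
  apply: (form_lim_const form_on_dot _ _ _ lu) => // e e0.
  have [|//|N hN] := lim1 _ _ e e0; first by [].
  exists N => n /hN; have [[_ _ /(_ _ Ap) h] _] := huv n.
  have E : dot (uv n).1 p.2 = dot (uv n).2 p.1 by rewrite dotC h -dotC.
  by rewrite E.
- by apply: cK lu => n; case: (huv n) => -[].
Qed.
End Hilbert.

(** * Relations represented by closed forms *)

(** The values at [f + g] and [f + ig] determine the real and the imaginary part of [s f g]. This is
    needed because [form_sum] prescribes only the diagonal of the form. *)
Lemma polarization (R : realType) (V : lmodType R[i]) (E : set V)
    (s t : V -> V -> R[i]) : form_on E s -> form_on E t ->
  (forall f, E f -> s f f = t f f) ->
  forall f g, E f -> E g -> s f g = t f g.
Proof.
move=> sE tE st f g ef eg; have es : lin_subspace E by case: sE.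
have q h : E h -> quad s h = quad t h by move=> /st; rewrite /quad => ->.
have ez x y : E (f + (x +i* y)%C *: g).
  by apply: lin_subspaceD => //; exact: lin_subspaceZ.
have := q _ (ez 1 0); have := q _ (ez 0 1).
rewrite !(quad_line _ _ sE) // !(quad_line _ _ tE) // !q //.
case: (s f g) => a b; case: (t f g) => c d /= h1 h2.
by congr Complex; lra.
Qed.

Section Relations.
Variables (R : realType) (H : completeNormedModType R[i]).
Variable dot : {dot H for Num.conj}.
Hypothesis norm_dot : forall f : H, `|f| ^+ 2 = dot f f.
Implicit Types (A : set (H * H)) (D K : set H) (t : H -> H -> R[i]).

Let dotT : form_on setT dot := form_on_dot norm_dot.

Lemma linear_relationP A : linear_relation A <-> lin_subspace A /\ closed A.
Proof.
split=> -[[h0 h] cA]; split=> //; split.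
- by rewrite inE in h0.
- move=> a f g /mem_set hf /mem_set hg; apply: set_mem; exact: h.
- by rewrite inE.
- move=> a f g /set_mem hf /set_mem hg; apply: mem_set; exact: h.
Qed.

Lemma quad_dotB_ge f g : 2 * complex.Re (dot f g) <= quad dot g + quad dot f.
Proof.
have := quad_ge0 dotT (I : setT (f - g)); rewrite (quadB dotT) //; lra.
Qed.

(** The shape in which nonnegativity yields uniqueness: a nonnegative relation contains [(w, - w)]
    only for [w = 0]. *)
Lemma dot_opp_ge0 w : 0 <= dot (- w) w -> w = 0.
Proof.
rewrite linearNl lecE => /andP[_ /= h].
apply: (quad_dot_eq0 norm_dot); apply/eqP.
rewrite eq_le (quad_ge0 dotT) // andbT /quad.
by move: h; case: (dot w w) => a b /=; rewrite oppr_ge0.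
Qed.

Lemma form_lim_dotD (u v : nat -> H) f g :
  form_lim dot u f -> form_lim dot v g ->
  form_lim dot (fun n => u n + v n) (f + g).
Proof.
move=> uf vg e e0.
have [N1 h1] := uf (e / 4) ltac:(lra).
have [N2 h2] := vg (e / 4) ltac:(lra).
exists (maxn N1 N2) => n; rewrite geq_max => /andP[/h1 h3 /h2 h4].
have := quad_triangle dotT (I : setT (u n + v n)) (I : setT (f + g))
  (I : setT (f + v n)).
have -> : u n + v n - (f + v n) = u n - f by rewrite opprD addrACA subrr addr0.
have -> : f + v n - (f + g) = v n - g by rewrite opprD addrACA subrr add0r.
lra.
Qed.

(** Linearity and closedness come for free, as every adjoint in a closed subspace [K] has them. *)
Lemma nonneg_selfadjoint_inI K A : lin_subspace K ->
  (forall u f, (forall n, K (u n)) -> form_lim dot u f -> K f) ->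
  A = adjoint_in dot K A -> (forall p, A p -> 0 <= dot p.2 p.1) ->
  nonneg_selfadjoint_in dot K A.
Proof.
move=> sK cK AE A0; split=> //; apply/linear_relationP; split; last first.
  by rewrite AE; exact: closed_adjoint_in.
rewrite AE; split.
  by split=> [||p _] /=; [case: sK|case: sK|rewrite !linear0r].
move=> a f g [/= f1 f2 hf] [/= g1 g2 hg]; split=> [||p Ap] /=.
- by have [_] := sK; apply.
- by have [_] := sK; apply.
- by rewrite !linearPr /= hf // hg.
Qed.

Lemma nonneg_selfadjointI A :
  A = adjoint_in dot setT A -> (forall p, A p -> 0 <= dot p.2 p.1) ->
  nonneg_selfadjoint dot A.
Proof. exact: nonneg_selfadjoint_inI. Qed.

Lemma nsa_lin_subspace K A : nonneg_selfadjoint_in dot K A -> lin_subspace A.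
Proof. by move=> [/linear_relationP[]]. Qed.

(** The range of [I + A] is closed because [p.1 + p.2] controls [p.1] in norm, and a vector
    orthogonal to it vanishes by selfadjointness and nonnegativity. [riesz] supplies the projection
    [phi] of [h] onto the closure of the range. *)
Lemma range_one_plus A : nonneg_selfadjoint dot A ->
  forall h, exists f, A (f, h - f).
Proof.
move=> nA h; have sA := nsa_lin_subspace nA.
have [/linear_relationP[_ cA] AE A0] := nA.
pose D := [set f | exists p, A p /\ f = p.1 + p.2].
have sD : lin_subspace D.
  split; first by exists 0; split; [case: sA|rewrite addr0].
  move=> a _ _ [p [Ap ->]] [q [Aq ->]]; exists (a *: p + q); split.
    by have [_] := sA; apply.
  by rewrite /= scalerDr addrACA.
have [||u [phi _ [uD uphi hphi]]] := @riesz _ _ setT D dot (dot h) (quad dot h)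
    (complete_form_dot norm_dot) sD _ _ (fun f _ => quad_dotB_ge h f).
- by [].
- by move=> a f g _ _; rewrite linearPr.
have quad_sum p : A p -> quad dot p.1 <= quad dot (p.1 + p.2).
  move=> /A0; rewrite lecE => /andP[_ /= pos].
  rewrite (quadD dotT) // dotC.
  have := quad_ge0 dotT (I : setT p.2); move: pos.
  by case: (dot p.2 p.1) => a b /=; lra.
have /choice[p hp] n : exists p, A p /\ u n = p.1 + p.2 by exact: uD.
have pA n : A (p n) by case: (hp n).
have pu n : u n = (p n).1 + (p n).2 by case: (hp n).
have p1C : form_cauchy dot (fun n => (p n).1).
  move=> e e0; have [N hN] := form_lim_cauchy dotT (fun=> I) I uphi e0.
  exists N => m n Nm Nn; apply: le_lt_trans (hN m n Nm Nn).
  rewrite !pu opprD addrACA.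
  exact: (quad_sum _ (lin_subspaceB sA (pA m) (pA n))).
have [f _ p1f] := (complete_form_dot norm_dot).2 _ (fun=> I) p1C.
have p2f : form_lim dot (fun n => (p n).2) (phi - f).
  have p1N : form_lim dot (fun n => - (p n).1) (- f).
    move=> e /p1f[N hN]; exists N => n /hN.
    by rewrite (quad_distC dotT) // addrC opprK.
  have := form_lim_dotD uphi p1N; congr form_lim.
  by apply/funext => n; rewrite pu addrAC subrr add0r.
have Af : A (f, phi - f).
  apply: (closed_form_lim norm_dot cA _ p1f p2f) => n.
  by rewrite -surjective_pairing.
suff -> : h = phi by exists f.
apply/eqP; rewrite -subr_eq0; apply/eqP/dot_opp_ge0.
(* [h - phi] is orthogonal to all [q.1 + q.2], which says that this pair lies in the adjoint, that
   is, in [A]. *)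
suff : A (h - phi, - (h - phi)) by move/A0.
rewrite AE; split=> // q Aq /=.
have : dot (h - phi) (q.1 + q.2) = 0.
  by rewrite linearBl /= hphi ?subrr //; exists q.
rewrite linearDr linearNr /= => /eqP; rewrite addr_eq0 => /eqP e.
by rewrite dotC [in RHS]dotC e rmorphN opprK.
Qed.

(** * Closed forms and the relations they represent *)

Definition one_plus t := fun f g => dot f g + t f g.

Definition closed_form D t := form_on D t /\ complete_form D (one_plus t).

(** [D] may fail to be dense: [p.2] is determined by [p.1] up to the orthogonal complement of [D],
    which is the multivalued part. *)
Definition rel_of_form D t : set (H * H) :=
  [set p | D p.1 /\ forall g, D g -> dot p.2 g = t p.1 g].

Lemma quad_one_plus t f : quad (one_plus t) f = quad dot f + quad t f.
Proof. by rewrite /quad /one_plus; case: (dot f f) (t f f) => a b []. Qed.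

(** Riesz representation of [dot h] in the complete form inner product [one_plus t]. *)
Lemma rel_of_form_range D t : closed_form D t ->
  forall h, exists f, rel_of_form D t (f, h - f).
Proof.
move=> [tD tC] h; have sD : lin_subspace D by case: tD.
have [|||u [phi Dphi [_ _ hphi]]] := @riesz _ _ D D _ (dot h) (quad dot h)
    tC sD.
- by [].
- by move=> a f g _ _; rewrite linearPr.
- move=> f Df; rewrite quad_one_plus; have := quad_dotB_ge h f.
  by have := quad_ge0 tD Df; lra.
exists phi; split=> // g Dg /=.
by rewrite linearBl /= -(hphi _ Dg) addrAC subrr add0r.
Qed.

Lemma rel_of_form_nonneg D t p : form_on D t -> rel_of_form D t p ->
  0 <= dot p.2 p.1.
Proof. by move=> [_ _ _ t0] [Dp hp]; rewrite hp // t0. Qed.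

(** A symmetric relation [C] with [I + C] onto is selfadjoint: for [(g, g')] in the adjoint, the
    solution [u] of [(I + C) u = g + g'] turns out to be [g]. *)
Lemma rel_of_form_nsa D t : closed_form D t ->
  nonneg_selfadjoint dot (rel_of_form D t).
Proof.
move=> tDC; have [tD _] := tDC; have sD : lin_subspace D by case: tD.
apply: nonneg_selfadjointI; last by move=> p; exact: rel_of_form_nonneg.
have sym p q : rel_of_form D t p -> rel_of_form D t q ->
    dot p.2 q.1 = dot p.1 q.2.
  by move=> [Dp hp] [Dq hq]; rewrite hp // (form_onC tD) // -hq // -dotC.
apply/seteqP; split=> [p Cp|[g g'] [_ _ /= hg]].
  by split=> // q Cq; exact: sym.
have [u Cu] := rel_of_form_range tDC (g + g').
suff e : g = u.
  have -> : g' = g + g' - u by rewrite e addrAC subrr add0r.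
  by rewrite {1}e.
apply/eqP; rewrite -subr_eq0; apply/eqP; apply: (quad_dot_eq0 norm_dot).
(* Testing against the solution of [(I + C) v = g - u] makes [g - u] orthogonal to itself. *)
have [v Cv] := rel_of_form_range tDC (g - u).
have h1 := hg _ Cv; have h2 := sym _ _ Cv Cu.
have : dot (g - u - v) (g - u) = - dot v (g - u).
  rewrite linearBr /= h1 h2 /= -linearBr -linearNr /=; congr (dot v _).
  by rewrite opprB opprD addrA opprB addrCA addrAC subrr add0r addrC.
rewrite linearBl /= => /eqP; rewrite subr_eq addNr => /eqP h3.
by rewrite /quad h3.
Qed.

Lemma form_lim_one_plus D t u f : form_on D t -> (forall n, D (u n)) -> D f ->
  form_lim (one_plus t) u f -> form_lim dot u f.
Proof.
move=> tD Du Df uf e /uf[N hN]; exists N => n /hN; rewrite quad_one_plus.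
have sD : lin_subspace D by case: tD.
have := quad_ge0 tD (lin_subspaceB sD (Du n) Df); lra.
Qed.

(** For [(f, f')] in the common relation both form inner products with [f] are [dot (f + f')].
    Density of its domain in the first form norm and closedness of the second form extend this
    agreement to all of [D1]. *)
Lemma rel_of_form_incl D1 t1 D2 t2 : closed_form D1 t1 -> closed_form D2 t2 ->
  rel_of_form D1 t1 = rel_of_form D2 t2 ->
  D1 `<=` D2 /\ forall f g, D1 f -> D1 g -> t1 f g = t2 f g.
Proof.
move=> c1 c2 C12; have [t1D [s1D s1C]] := c1; have [t2D [s2D s2C]] := c2.
pose C := rel_of_form D1 t1; pose dC := [set f | exists f', C (f, f')].
have sC : lin_subspace C by exact: nsa_lin_subspace (rel_of_form_nsa c1).
have sdC : lin_subspace dC.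
  split; first by exists 0; case: sC.
  move=> a f g [f' Cf] [g' Cg]; exists (a *: f' + g').
  by have [_ /(_ a _ _ Cf Cg)] := sC.
have dC1 : dC `<=` D1 by move=> f [f' []].
have dC2 : dC `<=` D2 by move=> f [f']; rewrite /C C12 => -[].
have eqs f phi : dC f -> D1 phi -> D2 phi ->
    one_plus t1 f phi = one_plus t2 f phi.
  move=> [f' Cf] p1 p2; rewrite /one_plus.
  have [_ /(_ _ p1) /= <-] := Cf.
  have : rel_of_form D2 t2 (f, f') by rewrite -C12.
  by move=> [_ /(_ _ p2) /= <-].
have eqq f : dC f -> quad (one_plus t1) f = quad (one_plus t2) f.
  by move=> df; rewrite /quad eqs //; [exact: dC1|exact: dC2].
(* dom C is a core: phi - phi' is orthogonal to ran (I + C), which is H. *)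
have core phi : D1 phi -> exists u, [/\ forall n, dC (u n),
    form_lim (one_plus t1) u phi, D2 phi & form_lim (one_plus t2) u phi].
  move=> D1phi.
  have [|||u [phi' D1phi' [uC uphi hphi]]] := @riesz _ _ D1 dC _
    (one_plus t1 phi) (quad (one_plus t1) phi) (conj s1D s1C) sdC.
  - by [].
  - move=> a f g df dg; have sD1 : lin_subspace D1 by case: t1D.
    rewrite (form_onDr s1D) ?(form_onZr _ s1D) //; try exact: dC1.
    by apply: lin_subspaceZ => //; exact: dC1.
  - move=> f df; have sD1 : lin_subspace D1 by case: t1D.
    have := quad_ge0 s1D (lin_subspaceB sD1 D1phi (dC1 _ df)).
    rewrite (quadB s1D) //; last exact: dC1.
    by lra.
  have phiE : phi' = phi.
    apply/eqP; rewrite -subr_eq0; apply/eqP.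
    have sD1 : lin_subspace D1 by case: t1D.
    have [v Cv] := rel_of_form_range c1 (phi' - phi).
    have dv : dC v by eexists; exact: Cv.
    have := hphi v dv => /eqP.
    rewrite -subr_eq0 -(form_onBl s1D) //; last exact: dC1.
    rewrite (form_onC s1D) //; [|exact: lin_subspaceB|exact: dC1].
    have [_ /= h] := Cv.
    rewrite /one_plus -h; last exact: lin_subspaceB.
    rewrite -linearDl /= addrC subrK => h0.
    apply: (quad_dot_eq0 norm_dot); rewrite /quad.
    by move: h0; case: (dot _ _) => a b /eqP[].
  rewrite {}phiE in uphi.
  have D1u n : D1 (u n) by exact: dC1.
  have D2u n : D2 (u n) by exact: dC2.
  (* The two form norms coincide on [dC], so [u] converges in the second one too; the limits agree
     because both are limits in [H]. *)
  have u2C : form_cauchy (one_plus t2) u.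
    move=> e e0; have [N hN] := form_lim_cauchy s1D D1u D1phi uphi e0.
    exists N => m n Nm Nn; rewrite -eqq; first exact: hN.
    exact: lin_subspaceB.
  have [l D2l ul] := s2C u D2u u2C.
  have lE : l = phi.
    apply/eqP; rewrite -subr_eq0; apply/eqP/(quad_dot_eq0 norm_dot).
    apply: (form_lim_unique dotT (u := u)) => //.
      exact: (form_lim_one_plus t2D).
    exact: (form_lim_one_plus t1D).
  by rewrite lE in D2l ul; exists u; split.
split=> [phi /core[u []] //|f g D1f D1g].
have [u [uC uf1 D2f uf2]] := core f D1f; have [_ [_ _ D2g _]] := core g D1g.
suff h : one_plus t1 f g = one_plus t2 f g by exact: (addrI (dot f g)).
apply: (form_lim_const s1D _ _ _ uf1) => //; first by move=> n; exact: dC1.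
move=> e e0.
have D2u n : D2 (u n) by exact: dC2.
have [N hN] := form_lim_left s2D D2u D2f D2g uf2 e0.
by exists N => n /hN; rewrite eqs.
Qed.

Lemma rel_of_form_inj D1 t1 D2 t2 : closed_form D1 t1 -> closed_form D2 t2 ->
  rel_of_form D1 t1 = rel_of_form D2 t2 ->
  D1 = D2 /\ forall f g, D1 f -> D1 g -> t1 f g = t2 f g.
Proof.
move=> c1 c2 C12; have [D12 t12] := rel_of_form_incl c1 c2 C12.
by have [D21 _] := rel_of_form_incl c2 c1 (esym C12); split=> //; exact/seteqP.
Qed.

Lemma eq_rel_of_form D t1 t2 :
  (forall f g, D f -> D g -> t1 f g = t2 f g) ->
  rel_of_form D t1 = rel_of_form D t2.
Proof.
move=> h; apply/seteqP; split=> p [Dp hp]; split=> // g Dg; rewrite hp ?h //.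
Qed.

(** * Sums and multiples of closed forms *)

Lemma form_on_sub E D t : form_on E t -> lin_subspace D -> D `<=` E ->
  form_on D t.
Proof.
move=> [sE tl tC t0] sD DE; split=> //.
- by move=> a f g h /DE ? /DE ? /DE ?; exact: tl.
- by move=> f g /DE ? /DE ?; exact: tC.
- by move=> f /DE; exact: t0.
Qed.

Lemma form_on_add D t1 t2 : form_on D t1 -> form_on D t2 ->
  form_on D (fun f g => t1 f g + t2 f g).
Proof.
move=> [sD l1 C1 p1] [_ l2 C2 p2]; split=> //.
- by move=> a f g h Df Dg Dh; rewrite l1 // l2 // mulrDr addrACA.
- by move=> f g Df Dg; rewrite rmorphD /= -C1 // -C2.
- by move=> f Df; rewrite addr_ge0 ?p1 ?p2.
Qed.

Lemma form_on_scale D t (c : R) : form_on D t -> 0 <= c ->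
  form_on D (fun f g => c%:C%C * t f g).
Proof.
move=> [sD l C p] c0; split=> //.
- by move=> a f g h Df Dg Dh; rewrite l // mulrDr mulrCA.
- move=> f g Df Dg; rewrite rmorphM (C f) //; congr (_ * _).
  by rewrite /= oppr0.
- by move=> f Df; rewrite mulr_ge0 ?p // ler0c.
Qed.

Lemma form_on_one_plus D t : form_on D t -> form_on D (one_plus t).
Proof.
move=> tD; apply: form_on_add => //; have sD : lin_subspace D by case: tD.
exact: form_on_sub dotT sD _.
Qed.

Lemma quad_add t1 t2 f :
  quad (fun f g => t1 f g + t2 f g) f = quad t1 f + quad t2 f.
Proof. by rewrite /quad; case: (t1 f f) (t2 f f) => a b []. Qed.

Lemma quad_scale t (c : R) f :
  quad (fun f g => c%:C%C * t f g) f = c * quad t f.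
Proof. by rewrite /quad; case: (t f f) => a b /=; rewrite mul0r subr0. Qed.

(** A Cauchy sequence for the sum is Cauchy for each summand, and the two form limits coincide as
    limits in [H]. *)
Lemma closed_formD D1 t1 D2 t2 : closed_form D1 t1 -> closed_form D2 t2 ->
  closed_form (D1 `&` D2) (fun f g => t1 f g + t2 f g).
Proof.
move=> [t1D [_ s1C]] [t2D [_ s2C]].
have sD1 : lin_subspace D1 by case: t1D.
have sD2 : lin_subspace D2 by case: t2D.
have sD : lin_subspace (D1 `&` D2).
  split; first by case: sD1 sD2 => ? _ [].
  move=> a f g [f1 f2] [g1 g2].
  by split; [have [_] := sD1|have [_] := sD2]; apply.
have tD : form_on (D1 `&` D2) (fun f g => t1 f g + t2 f g).
  by apply: form_on_add; apply: form_on_sub sD _; try eassumption; move=> f [].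
split=> //; split; first exact: form_on_one_plus.
move=> u Du uC.
have D1u n : D1 (u n) by case: (Du n).
have D2u n : D2 (u n) by case: (Du n).
have [||f D1f uf] := s1C u.
- by [].
- move=> e /uC[N hN]; exists N => m n Nm Nn; have := hN m n Nm Nn.
  rewrite !quad_one_plus quad_add.
  have := quad_ge0 t2D (lin_subspaceB sD2 (D2u m) (D2u n)); lra.
have [||g D2g ug] := s2C u.
- by [].
- move=> e /uC[N hN]; exists N => m n Nm Nn; have := hN m n Nm Nn.
  rewrite !quad_one_plus quad_add.
  have := quad_ge0 t1D (lin_subspaceB sD1 (D1u m) (D1u n)); lra.
have e : g = f.
  apply/eqP; rewrite -subr_eq0; apply/eqP/(quad_dot_eq0 norm_dot).
  apply: (form_lim_unique dotT (u := u)) => //.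
    exact: (form_lim_one_plus t2D) ug.
  exact: (form_lim_one_plus t1D) uf.
rewrite {}e in D2g ug; exists f => // e e0.
have [N1 h1] := uf (e / 2) ltac:(lra).
have [N2 h2] := ug (e / 2) ltac:(lra).
exists (maxn N1 N2) => n; rewrite geq_max => /andP[/h1 h3 /h2 h4].
move: h3 h4; rewrite !quad_one_plus quad_add.
have := quad_ge0 dotT (I : setT (u n - f)); lra.
Qed.

(** With [c = 1/2] this is the form of [(I + A)/2]. Its form norm is equivalent to that of [t]: the
    ratio of the squares lies between [c] and [1 + c]. *)
Lemma closed_form_one_plus D t (c : R) : closed_form D t -> 0 < c ->
  closed_form D (fun f g => c%:C%C * one_plus t f g).
Proof.
move=> [tD [sC hC]] c0; have c0' := ltW c0.
have sD : lin_subspace D by case: tD.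
have tD' : form_on D (fun f g => c%:C%C * one_plus t f g).
  by apply: form_on_scale.
split=> //; split; first exact: form_on_one_plus.
move=> u Du uC.
have [||f Df uf] := hC u.
- by [].
- move=> e e0; have [N hN] := uC (c * e) (mulr_gt0 c0 e0).
  exists N => m n Nm Nn; have := hN m n Nm Nn.
  rewrite [X in X < _ -> _]quad_one_plus quad_scale.
  have := quad_ge0 dotT (I : setT (u m - u n)) => q0 q1.
  rewrite -(ltr_pM2l c0); lra.
exists f => // e e0; have c1 : 0 < 1 + c by lra.
have [N hN] := uf (e / (1 + c)) (divr_gt0 e0 c1).
exists N => n /hN; rewrite ltr_pdivlMr //.
rewrite [X in _ -> X < _]quad_one_plus quad_scale.
rewrite quad_one_plus.
have := quad_ge0 tD (lin_subspaceB sD (Du n) Df); nra.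
Qed.
End Relations.

(** * Square roots of bounded operators *)

Section SquareRoot.
Variables (R : realType) (H : completeNormedModType R[i]).
Variable dot : {dot H for Num.conj}.
Hypothesis norm_dot : forall f : H, `|f| ^+ 2 = dot f f.
Implicit Types (T X Y Z : H -> H).

Let dotT : form_on setT dot := form_on_dot norm_dot.

(** An everywhere defined symmetric map is linear ([symmetric_linear]), so symmetry carries
    linearity with it. *)
Definition sa_contraction T : Prop :=
  (forall f g, dot (T f) g = dot f (T g)) /\
  forall f, quad dot (T f) <= quad dot f.

Lemma symmetric_linear T : (forall f g, dot (T f) g = dot f (T g)) -> linear T.
Proof.
move=> sT a f g; apply: (dot_inj norm_dot) => h.
by rewrite sT !linearPl /= !sT.
Qed.

Lemma sa_contractionB T f g : sa_contraction T -> T (f - g) = T f - T g.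
Proof.
move=> [sT _]; rewrite addrC -scaleN1r (symmetric_linear sT).
by rewrite scaleN1r addrC.
Qed.

Lemma symmetric_Im0 T f : (forall f g, dot (T f) g = dot f (T g)) ->
  complex.Im (dot (T f) f) = 0.
Proof.
move=> sT; have : dot (T f) f = conjc (dot (T f) f) by rewrite -dotC sT.
by case: (dot _ _) => a b [] /= h; lra.
Qed.

Lemma form_lim_contraction T u f : sa_contraction T ->
  form_lim dot u f -> form_lim dot (fun n => T (u n)) (T f).
Proof.
move=> cT uf e /uf[N hN]; exists N => n /hN; apply: le_lt_trans.
by rewrite -sa_contractionB //; have [_] := cT; apply.
Qed.

Lemma form_lim_dot_unique u f g :
  form_lim dot u f -> form_lim dot u g -> f = g.
Proof.
move=> uf ug; apply/eqP; rewrite -subr_eq0; apply/eqP/(quad_dot_eq0 norm_dot).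
exact: (form_lim_unique dotT (u := u)).
Qed.

(* Polynomials in T without constant term and with nonnegative coefficients;
   the index is the value of the polynomial at 1, hence a bound for its norm
   when T is a contraction. *)
Inductive nonneg_poly T : R -> (H -> H) -> Prop :=
| NPvar : nonneg_poly T 1 T
| NPzero : nonneg_poly T 0 (fun=> 0)
| NPadd a b X Y : nonneg_poly T a X -> nonneg_poly T b Y ->
    nonneg_poly T (a + b) (fun f => X f + Y f)
| NPcomp a b X Y : nonneg_poly T a X -> nonneg_poly T b Y ->
    nonneg_poly T (a * b) (fun f => X (Y f))
| NPhalf a X : nonneg_poly T a X ->
    nonneg_poly T (a / 2) (fun f => 2^-1 *: X f).

Lemma nonneg_poly_linear T a X : linear T -> nonneg_poly T a X -> linear X.
Proof.
move=> lT; elim=> {a X} [||a b X Y _ lX _ lY|a b X Y _ lX _ lY|a X _ lX] //.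
- by move=> a f g; rewrite scaler0 addr0.
- by move=> c f g; rewrite lX lY scalerDr addrACA.
- by move=> c f g; rewrite lY lX.
- by move=> c f g; rewrite lX scalerDr !scalerA mulrC.
Qed.

Lemma nonneg_poly_comm T a X Z : linear Z -> (forall f, T (Z f) = Z (T f)) ->
  nonneg_poly T a X -> forall f, X (Z f) = Z (X f).
Proof.
move=> lZ cZ; have Z0 : Z 0 = 0.
  by have := lZ (-1) 0 0; rewrite scaler0 addr0 scaleN1r addNr.
have ZZ b g : Z (b *: g) = b *: Z g by have := lZ b g 0; rewrite Z0 !addr0.
have ZD g h : Z (g + h) = Z g + Z h by have := lZ 1 g h; rewrite !scale1r.
elim=> {a X} [||a b X Y _ hX _ hY|a b X Y _ hX _ hY|a X _ hX] f //.
- by rewrite hX hY ZD.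
- by rewrite hY hX.
- by rewrite hX ZZ.
Qed.

Lemma nonneg_poly_symmetric T a X : (forall f g, dot (T f) g = dot f (T g)) ->
  nonneg_poly T a X -> forall f g, dot (X f) g = dot f (X g).
Proof.
move=> sT; have lT := symmetric_linear sT.
elim=> {a X} [||a b X Y hX sX hY sY|a b X Y hX sX hY sY|a X hX sX] f g //.
- by rewrite linear0l linear0r.
- by rewrite linearDl linearDr /= sX sY.
(* [X] and [Y] are polynomials in the same [T], hence commute. *)
- rewrite sX sY; congr (dot f _).
  apply: (nonneg_poly_comm (nonneg_poly_linear lT hX) _ hY) => {}f.
  by rewrite (nonneg_poly_comm lT _ hX).
- rewrite linearZl_LR linearZr_LR /= sX; congr (_ * _).
  by rewrite fmorphV /= rmorph_nat.
Qed.

Lemma nonneg_poly_norm T a X : (forall f, `|T f| <= `|f|) ->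
  nonneg_poly T a X -> 0 <= a /\ forall f, `|X f| <= a%:C%C * `|f|.
Proof.
move=> hT; elim=> {a X} [||a b X Y _ [a0 hX] _ [b0 hY]
    |a b X Y _ [a0 hX] _ [b0 hY]|a X _ [a0 hX]].
- by split=> // f; rewrite mul1r.
- by split=> // f; rewrite normr0 mul0r.
- split=> [|f]; first exact: addr_ge0.
  by rewrite rmorphD mulrDl; apply: le_trans (ler_normD _ _) _; apply: lerD.
- split=> [|f]; first exact: mulr_ge0.
  apply: le_trans (hX _) _; rewrite rmorphM -mulrA.
  by apply: ler_wpM2l; rewrite ?ler0c.
- split=> [|f]; first by rewrite divr_ge0.
  rewrite normrZ normfV normr_nat rmorphM fmorphV rmorph_nat mulrAC mulrC.
  by apply: ler_wpM2r; rewrite ?invr_ge0.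
Qed.

(** A limit [X] satisfies [2 X = T + X^2], that is, [(I - X)^2 = I - T]. *)
Fixpoint sqrt_iter T n : H -> H :=
  if n is m.+1 then fun f => 2^-1 *: (T f + sqrt_iter T m (sqrt_iter T m f))
  else fun=> 0.

(** The same iteration with [T] replaced by the number 1; it increases to the fixed point 1. *)
Fixpoint sqrt_iter_bound n : R :=
  if n is m.+1 then (1 + sqrt_iter_bound m * sqrt_iter_bound m) / 2 else 0.

(** One step maps [d = 1 - a] to [d - d^2 / 2], which is increasing on [[0, 1]]; at [d = 2 / x] this
    is at most [2 / (x + 1)], as [(x - 1) (x + 1) <= x^2]. *)
Lemma sqrt_iter_bound_itv n :
  [/\ 0 <= sqrt_iter_bound n, sqrt_iter_bound n <= 1 &
      1 - sqrt_iter_bound n <= 2 / n.+2%:R].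
Proof.
elim: n => [|n [h0 h1 h2]] /=; first by split=> //; lra.
move: (sqrt_iter_bound n) h0 h1 h2 => a h0 h1; rewrite -[n.+3]addn1 natrD.
have : 2 <= n.+2%:R :> R by rewrite ler_nat.
move: n.+2%:R => x x2; rewrite !ler_pdivlMr; try by lra.
move=> h2; split; nra.
Qed.

Lemma sqrt_iter_poly T n : nonneg_poly T (sqrt_iter_bound n) (sqrt_iter T n).
Proof.
elim: n => [|n ih] /=; first exact: NPzero.
by apply/NPhalf/NPadd; [exact: NPvar|exact: NPcomp].
Qed.

(** The identity [2 (X_{n+2} - X_{n+1}) = (X_{n+1} - X_n) X_{n+1} + X_n (X_{n+1} - X_n)] keeps the
    coefficients nonnegative. For a contraction [T] the norms of the differences are thus bounded by
    differences of numbers, which telescope. *)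
Lemma sqrt_iter_diff T n : linear T ->
  nonneg_poly T (sqrt_iter_bound n.+1 - sqrt_iter_bound n)
    (fun f => sqrt_iter T n.+1 f - sqrt_iter T n f).
Proof.
move=> lT; elim: n => [|n ih].
  rewrite subr0; have := sqrt_iter_poly T 1; congr nonneg_poly.
  by apply/funext => f; rewrite subr0.
have := NPhalf (NPadd (NPcomp ih (sqrt_iter_poly T n.+1))
  (NPcomp (sqrt_iter_poly T n) ih)).
congr nonneg_poly.
  have -> : sqrt_iter_bound n.+2 =
    (1 + sqrt_iter_bound n.+1 * sqrt_iter_bound n.+1) / 2 by [].
  have : sqrt_iter_bound n.+1 =
    (1 + sqrt_iter_bound n * sqrt_iter_bound n) / 2 by [].
  by move: (sqrt_iter_bound n.+1) (sqrt_iter_bound n) => b a ->; field.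
apply/funext => f; set X := sqrt_iter T n; set Y := sqrt_iter T n.+1.
have lX := nonneg_poly_linear lT (sqrt_iter_poly T n).
have -> : sqrt_iter T n.+2 f = 2^-1 *: (T f + Y (Y f)) by [].
have -> : X (Y f - X f) = X (Y f) - X (X f).
  by rewrite addrC -scaleN1r [LHS]lX scaleN1r addrC.
rewrite {5}/Y /= -/X -scalerBr; congr (_ *: _).
by rewrite addrA subrK opprD addrACA subrr add0r.
Qed.

Lemma sqrt_iter_cauchy T m n f : linear T -> (forall g, `|T g| <= `|g|) ->
  (n <= m)%N ->
  `|sqrt_iter T m f - sqrt_iter T n f| <=
    (sqrt_iter_bound m - sqrt_iter_bound n)%:C%C * `|f|.
Proof.
move=> lT hT; elim: m => [|m ih].
  by rewrite leqn0 => /eqP ->; rewrite !subrr normr0 mul0r.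
rewrite leq_eqVlt => /predU1P[->|nm]; first by rewrite !subrr normr0 mul0r.
have [_ /(_ f) h] := nonneg_poly_norm hT (sqrt_iter_diff m lT).
rewrite -(subrK (sqrt_iter T m f) (sqrt_iter T m.+1 f)) -addrA.
apply: le_trans (ler_normD _ _) _; apply: le_trans (lerD h (ih nm)) _.
by rewrite -mulrDl -rmorphD addrA subrK.
Qed.

Lemma quad_dot_le f (c : R) g : 0 <= c -> `|f| <= c%:C%C * `|g| ->
  quad dot f <= c ^+ 2 * quad dot g.
Proof.
move=> c0; rewrite !(quad_dot norm_dot) -exprMn.
rewrite [in X in X -> _](normE f) [in X in X -> _](normE g) -rmorphM lecR => h.
have n0 h' : 0 <= complex.Re `|h' : H|.
  by rewrite -lecR -normE; exact: normr_ge0.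
by rewrite ler_sqr // nnegrE // mulr_ge0.
Qed.

Lemma quad_dot_le_norm f g : quad dot f <= quad dot g -> `|f| <= `|g|.
Proof.
rewrite !(quad_dot norm_dot) (normE f) (normE g) lecR /=.
have n0 h' : 0 <= complex.Re `|h' : H|.
  by rewrite -lecR -normE; exact: normr_ge0.
by rewrite ler_sqr ?nnegrE.
Qed.

Lemma sqrt_iter_lim T : sa_contraction T ->
  exists X, forall f, form_lim dot (fun n => sqrt_iter T n f) (X f).
Proof.
move=> [sT cT].
suff : forall f, exists g, form_lim dot (fun n => sqrt_iter T n f) g.
  by move=> /choice[X hX]; exists X.
move=> f; suff /((complete_form_dot norm_dot).2 _ (fun=> I)) [g _ hg] :
  form_cauchy dot (fun n => sqrt_iter T n f) by exists g.
move=> e e0; have q0 := quad_ge0 dotT (I : setT f).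
(* The squared bound on the difference will be at most [4 * d], and [4 * d * quad dot f < e]. *)
pose d := e / (4 * (quad dot f + 1)).
have d0 : 0 < d by rewrite divr_gt0 // mulr_gt0 // ltr_wpDl.
have [N hN] := inv_succ_lt d0.
have step m n : (N <= n)%N -> (n <= m)%N ->
    quad dot (sqrt_iter T m f - sqrt_iter T n f) < e.
  move=> Nn nm.
  have hT g : `|T g| <= `|g| by exact: quad_dot_le_norm.
  have := sqrt_iter_cauchy f (symmetric_linear sT) hT nm.
  have [a0 a1 _] := sqrt_iter_bound_itv m.
  have [b0 b1 b2] := sqrt_iter_bound_itv n.
  set c := sqrt_iter_bound m - sqrt_iter_bound n.
  have c0 : 0 <= c.
    rewrite subr_ge0.
    elim: m nm {a0 a1 c} => [|m ih]; first by rewrite leqn0 => /eqP ->.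
    rewrite leq_eqVlt => /predU1P[->//|/ih h]; apply: le_trans h _.
    have [+ _] := nonneg_poly_norm hT (sqrt_iter_diff m (symmetric_linear sT)).
    by rewrite subr_ge0.
  move=> /(quad_dot_le c0) /le_lt_trans; apply.
  have : c <= 2 / n.+2%:R by apply: le_trans b2; rewrite lerD2r.
  have h1 : n.+1%:R^-1 < d by exact: hN.
  have h2 : n.+2%:R^-1 <= n.+1%:R^-1 :> R.
    by rewrite lef_pV2 ?posrE ?ltr0n // ler_nat.
  have h3 : n.+2%:R^-1 <= 2^-1 :> R.
    by rewrite lef_pV2 ?posrE ?ltr0n // ler_nat.
  have h4 : 0 < n.+2%:R^-1 :> R by rewrite invr_gt0 ltr0n.
  move: n.+2%:R^-1 n.+1%:R^-1 h1 h2 h3 h4 => x y h1 h2 h3 h4 h5.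
  have h6 : c ^+ 2 <= 4 * d.
    apply: le_trans (_ : (2 * x) ^+ 2 <= _).
      by rewrite ler_sqr ?nnegrE // mulr_ge0 // ltW.
    have : x * x <= 2^-1 * x by rewrite ler_wpM2r // ltW.
    by rewrite exprMn !expr2; lra.
  apply: (@le_lt_trans _ _ (4 * d * quad dot f)); first exact: ler_wpM2r.
  rewrite /d.
  have -> : 4 * (e / (4 * (quad dot f + 1))) = e / (quad dot f + 1).
    by field; rewrite gt_eqF // ltr_wpDl.
  rewrite mulrAC ltr_pdivrMr ?ltr_wpDl //.
  by rewrite ltr_pM2l // ltrDl.
exists N => m n Nm Nn; case: (leqP n m) => [nm|/ltnW mn]; first exact: step.
by rewrite (quad_distC dotT) //; exact: step.
Qed.

(** [P = I - X] for the limit [X] of the iteration, nonnegative because [X] is a contraction. Since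
    [I - P] is again a symmetric contraction, [P] has a square root in turn; the last clause makes
    the various roots commute. *)
Lemma operator_sqrt T : sa_contraction T -> exists P : H -> H,
  [/\ sa_contraction (fun f => f - P f),
      forall f g, dot (P f) g = dot f (P g),
      forall f, 0 <= dot (P f) f,
      forall f, P (P f) = f - T f &
      forall Z, sa_contraction Z -> (forall f, T (Z f) = Z (T f)) ->
        forall f, P (Z f) = Z (P f)].
Proof.
move=> cT; have [sT dT] := cT; have [X hX] := sqrt_iter_lim cT.
have lT := symmetric_linear sT.
have hT g : `|T g| <= `|g| by exact: quad_dot_le_norm.
have sXn n f g : dot (sqrt_iter T n f) g = dot f (sqrt_iter T n g).
  exact: nonneg_poly_symmetric (sqrt_iter_poly T n) f g.
have cXn n f : quad dot (sqrt_iter T n f) <= quad dot f.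
  have [a0 a1 _] := sqrt_iter_bound_itv n.
  have [_ /(_ f) h] := nonneg_poly_norm hT (sqrt_iter_poly T n).
  apply: le_trans (quad_dot_le a0 h) _.
  rewrite -[leRHS]mul1r ler_wpM2r ?(quad_ge0 dotT) //.
  by rewrite expr_le1.
have saXn n : sa_contraction (sqrt_iter T n) by [].
have sX f g : dot (X f) g = dot f (X g).
  apply: (form_lim_const dotT _ _ _ (hX f)) => // e e0.
  have [N hN] := form_lim_left dotT (fun=> I) I (I : setT f) (hX g) e0.
  exists N => n /hN.
  have -> : dot (sqrt_iter T n f) g - dot f (X g) =
      conjc (dot (sqrt_iter T n g) f - dot (X g) f).
    by rewrite sXn rmorphB /= -!dotC.
  by case: (_ - _) => a b /=; rewrite sqrrN.
have cX f : quad dot (X f) <= quad dot f.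
  (* Otherwise the real part of [dot (X_N f) (X f)] stays below [quad dot (X f)] by at least
     [d / 2], the [X_N] being contractions, although it tends to that value. *)
  rewrite leNgt; apply/negP => h.
  pose d := quad dot (X f) - quad dot f.
  have d0 : 0 < (d / 2) ^+ 2 by rewrite exprn_gt0 // divr_gt0 // subr_gt0.
  have [N /(_ N (leqnn N))] :=
    form_lim_left dotT (fun=> I) I (I : setT (X f)) (hX f) d0.
  have := quad_dotB_ge norm_dot (sqrt_iter T N f) (X f); have := cXn N f.
  move: h d0; rewrite /d /quad.
  case: (dot (X f) (X f)) => a1 b1; case: (dot f f) => a2 b2.
  case: (dot (sqrt_iter T N f) (X f)) => a3 b3.
  case: (dot (sqrt_iter T N f) _) => a4 b4 /= h1 h2 h3 h4 h5.
  have h6 := sqr_ge0 (b3 - b1).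
  have : (a1 - a3) ^+ 2 < ((a1 - a2) / 2) ^+ 2 by rewrite -sqrrN opprB; lra.
  by rewrite ltr_sqr ?nnegrE; lra.
have saX : sa_contraction X by [].
have XE f : X f + X f = T f + X (X f).
  have shift : form_lim dot (fun n => sqrt_iter T n.+1 f) (X f).
    move=> e e0; have [N hN] := hX f e e0.
    by exists N => n Nn; apply: hN; exact: leqW.
  apply: (form_lim_dot_unique (form_lim_dotD norm_dot shift shift)).
  (* [X_n (X_n f)] is [X_n (X f)] plus [X_n (X_n f - X f)], and the last term tends to 0 because the
     [X_n] are contractions. *)
  have lim2 : form_lim dot (fun n => sqrt_iter T n (sqrt_iter T n f)) (X (X f)).
    have lim0 : form_lim dot (fun n => sqrt_iter T n (sqrt_iter T n f - X f)) 0.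
      move=> e e0; have [N hN] := hX f e e0; exists N => n /hN.
      apply: le_lt_trans.
      by rewrite subr0.
    have := form_lim_dotD norm_dot (hX (X f)) lim0; rewrite addr0.
    congr form_lim; apply/funext => n.
    by rewrite sa_contractionB // addrC subrK.
  have cst : form_lim dot (fun=> T f) (T f).
    by move=> e e0; exists 0%N => n _; rewrite subrr /quad linear0l.
  have := form_lim_dotD norm_dot cst lim2; congr form_lim.
  apply/funext => n /=; rewrite -scalerDl.
  have -> : 2^-1 + 2^-1 = 1 :> R[i] by field.
  by rewrite scale1r.
have comm Z : sa_contraction Z -> (forall f, T (Z f) = Z (T f)) ->
    forall f, X (Z f) = Z (X f).
  move=> cZ TZ f; have lZ := symmetric_linear cZ.1.
  apply: (form_lim_dot_unique (hX (Z f))).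
  have := form_lim_contraction cZ (hX f); congr form_lim.
  by apply/funext => n; rewrite (nonneg_poly_comm lZ TZ (sqrt_iter_poly T n)).
exists (fun f => f - X f); split.
- have := saX; congr sa_contraction; apply/funext => f.
  by rewrite opprB addrC subrK.
- by move=> f g; rewrite linearBl linearBr /= sX.
- move=> f; rewrite linearBl /= lecE /=; have := symmetric_Im0 f sX.
  have := quad_dotB_ge norm_dot (X f) f; have := cX f.
  have := symmetric_Im0 f (fun f g => erefl (dot f g)).
  rewrite /quad; case: (dot (X f) f) => a b; case: (dot f f) => c d /=.
  by move=> -> h1 h2 ->; rewrite subr0 eqxx /=; lra.
- move=> f; rewrite sa_contractionB //.
  have -> : T f = X f + X f - X (X f) by rewrite XE addrK.
  by rewrite !opprB opprD !addrA (addrAC f).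
- by move=> Z cZ TZ f; rewrite comm // sa_contractionB.
Qed.
End SquareRoot.

(** * The closed form of a nonnegative selfadjoint relation *)

Section OperSqrt.
Variables (R : realType) (H : completeNormedModType R[i]).
Variable dot : {dot H for Num.conj}.
Hypothesis norm_dot : forall f : H, `|f| ^+ 2 = dot f f.
Implicit Types (A S : set (H * H)) (D K M : set H) (t : H -> H -> R[i]).

Let dotT : form_on setT dot := form_on_dot norm_dot.

Lemma lin_subspace_orthogonal_compl M : lin_subspace (orthogonal_compl dot M).
Proof.
split=> [m Mm|a f g hf hg m Mm]; first by rewrite linear0l.
by rewrite linearPl /= hf // hg // mulr0 addr0.
Qed.

Lemma form_lim_orthogonal_compl M (u : nat -> H) f :
  (forall n, orthogonal_compl dot M (u n)) -> form_lim dot u f ->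
  orthogonal_compl dot M f.
Proof.
move=> uM uf m Mm; apply: (form_lim_const dotT _ _ _ uf) => // e e0.
by exists 0%N => n _; rewrite uM // subrr expr0n addr0.
Qed.

Lemma nsa_sym K A p q : nonneg_selfadjoint_in dot K A -> A p -> A q ->
  dot p.2 q.1 = dot p.1 q.2.
Proof. by move=> [_ AE _] Ap; rewrite AE => -[_ _]; apply. Qed.

Lemma nsa_resolvent_unique A f f' g : nonneg_selfadjoint dot A ->
  A (f, f') -> A (g, f + f' - g) -> f = g.
Proof.
move=> nA Af Ag; have sA := nsa_lin_subspace nA.
apply/eqP; rewrite -subr_eq0; apply/eqP/(dot_opp_ge0 norm_dot).
have : A (f - g, f' - (f + f' - g)) by exact: (lin_subspaceB sA Af Ag).
have -> : f' - (f + f' - g) = - (f - g).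
  by rewrite !opprB opprD addrCA (addrCA f') subrr addr0.
by case: nA => _ _; apply.
Qed.

(** With [P = J^(1/2)] and [Q = (I - J)^(1/2)] one has [P^2 + Q^2 = I], and [A] consists of the
    pairs [(P^2 x, Q^2 x)]. The kernel of [P] is the multivalued part of [A], so restricting to its
    complement makes [S] single-valued. *)
Lemma oper_sqrt_exists A : nonneg_selfadjoint dot A ->
  exists S, [/\ nonneg_selfadjoint_in dot (oper_space dot A) S,
    rel_mul S = [set 0] & rel_comp S S = oper_part dot A].
Proof.
move=> nA; have sA := nsa_lin_subspace nA; have [_ _ A0] := nA.
have /choice[J hJ] := range_one_plus norm_dot nA.
have JE f f' : A (f, f') -> f = J (f + f').
  by move=> Af; exact: (nsa_resolvent_unique nA Af (hJ _)).
have Jpos f : quad dot (J f) <= complex.Re (dot f (J f)).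
  have /= := A0 _ (hJ f); rewrite lecE => /andP[_ /=].
  rewrite linearBl /quad /=; case: (dot f _) (dot (J f) _) => a b [] c d /=.
  by rewrite subr_ge0.
have JS f g : dot (J f) g = dot f (J g).
  have /= := nsa_sym nA (hJ f) (hJ g).
  by rewrite linearBl linearBr /= => /addIr.
have cJ : sa_contraction dot J.
  split=> // f; have := Jpos f; have := quad_dotB_ge norm_dot f (J f).
  have := quad_ge0 dotT (I : setT f); lra.
have cJ1 : sa_contraction dot (fun f => f - J f).
  split=> f; first by move=> g; rewrite linearBl linearBr /= JS.
  rewrite (quadB dotT) //; have := Jpos f.
  have := quad_ge0 dotT (I : setT (J f)); lra.
(* [operator_sqrt] yields the root of [I - T], so [I - J] is passed for [P] and [J] for [Q]. *)
have [P [cP1 sP P0 PP cP]] := operator_sqrt norm_dot cJ1.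
have [Q [_ sQ Q0 QQ cQ]] := operator_sqrt norm_dot cJ.
have PPJ f : P (P f) = J f by rewrite PP opprB addrC subrK.
have cQc : sa_contraction dot Q.
  split=> // f; rewrite /quad sQ QQ linearBr /=.
  have := Jpos f; have := quad_ge0 dotT (I : setT (J f)).
  by case: (dot f f) (dot f (J f)) => a b [] c d /=; lra.
have QJ f : Q (J f) = J (Q f) by rewrite cQ.
have PQ f : P (Q f) = Q (P f).
  by apply: cP => // g; rewrite (sa_contractionB norm_dot _ _ cQc) QJ.
(* P1 = P^(1/2) only serves to show that P Q is nonnegative. *)
have [P1 [_ sP1 _ PP1 cP1c]] := operator_sqrt norm_dot cP1.
have P1P f : P1 (P1 f) = P f by rewrite PP1 opprB addrC subrK.
have P1Q f : P1 (Q f) = Q (P1 f).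
  by apply: cP1c => // g; rewrite (sa_contractionB norm_dot _ _ cQc) PQ.
have linP := symmetric_linear norm_dot sP.
have linQ := symmetric_linear norm_dot sQ.
have PD f g : P (f + g) = P f + P g by have := linP 1 f g; rewrite !scale1r.
have QD f g : Q (f + g) = Q f + Q g by have := linQ 1 f g; rewrite !scale1r.
have P0' : P 0 = 0 by apply: (addrI (P 0)); rewrite -PD !addr0.
have Q0' : Q 0 = 0 by apply: (addrI (Q 0)); rewrite -QD !addr0.
pose K := oper_space dot A.
have sK : lin_subspace K by exact: lin_subspace_orthogonal_compl.
have mulJ m : rel_mul A m <-> J m = 0.
  split=> [/JE|Jm]; first by rewrite add0r => <-.
  by have := hJ m; rewrite Jm subr0.
have kerP m : P m = 0 <-> J m = 0.
  split=> [Pm|Jm]; first by rewrite -PPJ Pm P0'.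
  apply: (quad_dot_eq0 norm_dot).
  by rewrite /quad sP PPJ Jm linear0r.
have KP g : K (P g).
  by move=> m /mulJ/kerP Pm; rewrite sP Pm linear0r.
have KQ g : K g -> K (Q g).
  by move=> Kg m /mulJ Jm; rewrite sQ; apply: Kg; apply/mulJ; rewrite -QJ Jm.
have PKinj g : K g -> P g = 0 -> g = 0.
  move=> Kg /kerP/mulJ gm; apply: (quad_dot_eq0 norm_dot).
  by rewrite /quad Kg.
have PPQQ f : P (P f) + Q (Q f) = f by rewrite PPJ QQ addrC subrK.
pose S := [set p | exists2 g, K g & p = (P g, Q g)].
have AP p : A p <-> exists x, p = (P (P x), Q (Q x)).
  case: p => f f'; split=> [Af|[x [-> ->]]]; last by rewrite PPJ QQ; exact: hJ.
  exists (f + f'); rewrite PPJ QQ -(JE _ _ Af); congr pair.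
  by rewrite addrAC subrr add0r.
exists S; split.
- apply: nonneg_selfadjoint_inI => //.
  + by move=> u f; exact: form_lim_orthogonal_compl.
  + apply/seteqP; split=> [_ [g Kg ->]|[u v] [/= Ku Kv huv]].
      split=> /=; [exact: KP|exact: KQ|].
      by move=> _ [h Kh ->] /=; rewrite sQ sP PQ.
    (* Testing with the pair generated by [Q u - P v] shows that this vector vanishes; then
       [P u + Q v] generates [(u, v)]. *)
    have QuPv : Q u = P v.
      apply/eqP; rewrite -subr_eq0; apply/eqP/(quad_dot_eq0 norm_dot).
      have Kw : K (Q u - P v) by exact: (lin_subspaceB sK (KQ _ Ku) (KP v)).
      have /= e := huv (_, _) (ex_intro2 _ _ _ Kw erefl).
      by rewrite /quad linearBr /= -sQ -sP e subrr.
    exists (P u + Q v); first exact: (lin_subspaceD sK (KP u) (KQ _ Kv)).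
    by rewrite PD QD PQ -QuPv PPQQ -PQ QuPv PPQQ.
  + by move=> _ [g Kg ->] /=; rewrite -sP -P1P sP1 P1Q Q0.
- apply/seteqP; split=> [f' [g Kg [e ->]]|_ ->] /=.
    by rewrite (PKinj g Kg) ?Q0'.
  by exists 0; [case: sK|rewrite P0' Q0'].
- apply/seteqP; split=> [[f f'] [g [h Kh [-> gE]] [k Kk [gE' ->]]]|[f f']].
    split; last by move=> /=; exact: KQ.
    (* Since [Q h = P k], this [x] satisfies [P x = h] and [Q x = k]. *)
    apply/AP; exists (P h + Q k).
    have e1 : P (P h + Q k) = h by rewrite PD PQ -gE' gE PPQQ.
    have e2 : Q (P h + Q k) = k by rewrite QD -PQ -gE gE' PPQQ.
    by rewrite e1 e2.
  case=> /AP[x [-> ->]] /= Kx; have Kx' : K x.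
    by rewrite -(PPQQ x); exact: (lin_subspaceD sK (KP _) Kx).
  exists (Q (P x)); first by exists (P x) => //; exact: KP.
  by exists (Q x); [exact: KQ|rewrite PQ].
Qed.

Definition sqrt_form S : H -> H -> R[i] :=
  fun f g => dot (rel_apply S f) (rel_apply S g).

Lemma rel_applyE S f g : lin_subspace S -> rel_mul S = [set 0] -> S (f, g) ->
  rel_apply S f = g.
Proof.
move=> sS mS Sf; apply: xget_unique => // h Sh.
have : rel_mul S (h - g).
  have := lin_subspaceB sS Sh Sf; rewrite /rel_mul /=; congr S; congr pair.
  exact: subrr.
by rewrite mS => /= /eqP; rewrite subr_eq0 => /eqP.
Qed.

(** The form norm is the graph norm of [S], complete because [S] is closed. *)
Lemma closed_sqrt_form S : linear_relation S -> rel_mul S = [set 0] ->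
  closed_form dot (rel_dom S) (sqrt_form S).
Proof.
move=> /linear_relationP[sS cS] mS.
have {mS} aE f g : S (f, g) -> rel_apply S f = g by exact: rel_applyE.
have aP f : rel_dom S f -> S (f, rel_apply S f).
  by move=> [g Sf]; rewrite (aE _ _ Sf).
have sD : lin_subspace (rel_dom S).
  split; first by exists 0; case: sS.
  move=> a f g [f' Sf] [g' Sg]; exists (a *: f' + g').
  by have [_ /(_ a _ _ Sf Sg)] := sS.
have aL a f g : rel_dom S f -> rel_dom S g ->
    rel_apply S (a *: f + g) = a *: rel_apply S f + rel_apply S g.
  by move=> /aP Sf /aP Sg; apply: aE; have [_ /(_ a _ _ Sf Sg)] := sS.
have aB f g : rel_dom S f -> rel_dom S g ->
    rel_apply S (f - g) = rel_apply S f - rel_apply S g.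
  by move=> Sf Sg; rewrite addrC -scaleN1r aL // scaleN1r addrC.
have tD : form_on (rel_dom S) (sqrt_form S).
  split=> //.
  - by move=> a f g h Df Dg Dh; rewrite /sqrt_form aL // linearPl.
  - by move=> f g _ _; exact: dotC.
  - by move=> f _; rewrite /sqrt_form -norm_dot exprn_ge0.
split=> //; split; first exact: form_on_one_plus.
move=> u Du uC.
have qB m n : quad (one_plus dot (sqrt_form S)) (u m - u n) =
    quad dot (u m - u n) +
    quad dot (rel_apply S (u m) - rel_apply S (u n)).
  by rewrite quad_one_plus -aB.
have [f _ uf] : exists2 f, setT f & form_lim dot u f.
  apply: (complete_form_dot norm_dot).2 => // e /uC[N hN].
  exists N => m n Nm Nn; have := hN m n Nm Nn; rewrite qB.
  have := quad_ge0 dotT (I : setT (rel_apply S (u m) - rel_apply S (u n))); lra.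
have [g _ ug] : exists2 g, setT g & form_lim dot (fun n => rel_apply S (u n)) g.
  apply: (complete_form_dot norm_dot).2 => // e /uC[N hN].
  exists N => m n Nm Nn; have := hN m n Nm Nn; rewrite qB.
  have := quad_ge0 dotT (I : setT (u m - u n)); lra.
have Sf : S (f, g).
  by apply: (closed_form_lim norm_dot cS _ uf ug) => n; exact: aP.
have Df : rel_dom S f by exists g.
exists f => // e e0.
have [N1 h1] := uf (e / 2) ltac:(lra).
have [N2 h2] := ug (e / 2) ltac:(lra).
exists (maxn N1 N2) => n; rewrite geq_max => /andP[/h1 h3 /h2 h4].
rewrite quad_one_plus /quad /sqrt_form aB // (aE _ _ Sf).
by move: h3 h4; rewrite /quad; lra.
Qed.

(** Maximality of [A]: [I + A] is already onto, while [I] plus the larger nonnegative relation is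
    injective. *)
Lemma nsa_rel_of_form A D t : nonneg_selfadjoint dot A -> form_on D t ->
  A `<=` rel_of_form dot D t -> A = rel_of_form dot D t.
Proof.
move=> nA tD At; apply/seteqP; split=> // -[f f'] [/= Df hf].
have [g Ag] := range_one_plus norm_dot nA (f + f').
have [/= Dg hg] := At _ Ag; have sD : lin_subspace D by case: tD.
suff e : f = g by move: Ag; rewrite -e addrAC subrr add0r.
apply/eqP; rewrite -subr_eq0; apply/eqP/(dot_opp_ge0 norm_dot).
have Dw : D (f - g) by exact: lin_subspaceB.
have -> : - (f - g) = f' - (f + f' - g).
  by rewrite !opprB opprD addrCA (addrCA f') subrr addr0.
by rewrite linearBl /= hf // hg // -(form_onBl tD) //; case: tD => _ _ _; apply.
Qed.

(** [m] is the orthogonal projection of [f'] onto [rel_mul A], which is closed because [A] is. *)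
Lemma nsa_split A f f' : nonneg_selfadjoint dot A -> A (f, f') ->
  exists2 m, rel_mul A m & oper_part dot A (f, f' - m).
Proof.
move=> nA Af; have sA := nsa_lin_subspace nA.
have [/linear_relationP[_ cA] _ _] := nA.
have sM : lin_subspace (rel_mul A).
  split; first by case: sA.
  move=> a m n Am An; have [_ /(_ a _ _ Am An)] := sA; rewrite /rel_mul /=.
  by congr A; congr pair; rewrite /= scaler0 addr0.
have [||u [m _ [uM um hm]]] := @riesz _ _ setT (rel_mul A) dot (dot f')
    (quad dot f') (complete_form_dot norm_dot) sM _ _
    (fun g _ => quad_dotB_ge norm_dot f' g).
- by [].
- by move=> a g h _ _; rewrite linearPr.
have Am : rel_mul A m.
  have c0 : form_lim dot (fun=> 0) 0.
    by move=> e e0; exists 0%N => n _; rewrite /quad subrr linear0l.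
  exact: (closed_form_lim norm_dot cA uM c0 um).
exists m => //; split.
  by have := lin_subspaceB sA Af Am; congr A; congr pair; rewrite /= subr0.
by move=> n Mn; rewrite linearBl /= hm // subrr.
Qed.

Lemma oper_sqrtP A : nonneg_selfadjoint dot A ->
  [/\ nonneg_selfadjoint_in dot (oper_space dot A) (oper_sqrt dot A),
    rel_mul (oper_sqrt dot A) = [set 0] &
    rel_comp (oper_sqrt dot A) (oper_sqrt dot A) = oper_part dot A].
Proof. by move=> /oper_sqrt_exists; exact: xgetPex. Qed.

Definition oper_form A := sqrt_form (oper_sqrt dot A).

Lemma closed_oper_form A : nonneg_selfadjoint dot A ->
  closed_form dot (form_dom dot A) (oper_form A).
Proof.
by move=> /oper_sqrtP[[lS _ _] mS _]; exact: closed_sqrt_form.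
Qed.

(** By maximality it is enough that [A] lies in the relation of its form. For this [f'] is split
    along [rel_mul A], and symmetry of the root moves one factor across. *)
Lemma oper_formE A : nonneg_selfadjoint dot A ->
  A = rel_of_form dot (form_dom dot A) (oper_form A).
Proof.
move=> nA; have [tD _] := closed_oper_form nA.
apply: nsa_rel_of_form => // -[f f'] Af.
have [nS mS SS] := oper_sqrtP nA; have sS := nsa_lin_subspace nS.
have [m Am] := nsa_split nA Af; rewrite -SS => -[g /= Sf Sg].
split; first by exists g.
move=> phi [psi Sphi] /=; rewrite /oper_form /sqrt_form.
rewrite (rel_applyE sS mS Sf) (rel_applyE sS mS Sphi).
have := nsa_sym nS Sg Sphi; rewrite /= linearBl /= => <-.
(* The root lives in the complement of [rel_mul A], so [m] is orthogonal to [phi]. *)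
have [_ SE _] := nS; move: Sphi; rewrite SE => -[/= Kphi _ _].
by rewrite (dotC dot m) (Kphi _ Am) rmorph0 subr0.
Qed.

Lemma form_valE A f : form_val dot A f = oper_form A f f.
Proof. exact: norm_dot. Qed.

(** Resolves the choice in [form_sum]. By [rel_of_form_inj] the forms of represented relations are
    the given ones, so the relation of [t1 + t2] qualifies; any other candidate has the same form by
    [polarization], hence is the same relation. *)
Lemma form_sum_rel_of_form D1 t1 D2 t2 :
  closed_form dot D1 t1 -> closed_form dot D2 t2 ->
  form_sum dot (rel_of_form dot D1 t1) (rel_of_form dot D2 t2) =
  rel_of_form dot (D1 `&` D2) (fun f g => t1 f g + t2 f g).
Proof.
move=> c1 c2.
have eqf D t : closed_form dot D t ->
    D = form_dom dot (rel_of_form dot D t) /\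
    forall f g, D f -> D g -> t f g = oper_form (rel_of_form dot D t) f g.
  move=> c; have n := rel_of_form_nsa norm_dot c.
  apply: (rel_of_form_inj norm_dot c (closed_oper_form n)).
  exact: oper_formE.
have [d1 e1] := eqf _ _ c1; have [d2 e2] := eqf _ _ c2.
have c := closed_formD norm_dot c1 c2.
apply: xget_unique.
  have [d e] := eqf _ _ c; split; first exact: rel_of_form_nsa.
    by rewrite -d -d1 -d2.
  move=> f; rewrite -d => Df; have [Df1 Df2] := Df.
  by rewrite !form_valE -e // -e1 // -e2.
move=> C [nC dC vC]; rewrite (oper_formE nC) dC -d1 -d2.
apply: eq_rel_of_form; apply: polarization.
- by rewrite d1 d2 -dC; case: (closed_oper_form nC).
- by case: c.
- move=> f Df; have [Df1 Df2] := Df; rewrite -form_valE vC ?dC -?d1 -?d2 //.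
  by rewrite !form_valE -e1 // -e2.
Qed.
End OperSqrt.

(** * Cayley transforms *)

Section RelationAlgebra.
Variables (R : realType) (H : completeNormedModType R[i]).
Variable dot : {dot H for Num.conj}.
Hypothesis norm_dot : forall f : H, `|f| ^+ 2 = dot f f.
Implicit Types (A B C : set (H * H)) (D : set H) (t : H -> H -> R[i]).

(** Written as an embedded real to match the factor [c%:C%C] of [closed_form_one_plus]. *)
Let half : R[i] := (2^-1 : R)%:C%C.

Let halfE : half = 2^-1.
Proof. by rewrite /half fmorphV rmorph_nat. Qed.

Let half2 (f : H) : 2 *: (half *: f) = f.
Proof. by rewrite scalerA halfE divff ?scale1r // pnatr_eq0. Qed.

Let half_half (f : H) : half *: f + half *: f = f.
Proof.
rewrite -scalerDr -mulr2n -scaler_nat scalerA halfE.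
by rewrite mulVf ?scale1r // pnatr_eq0.
Qed.

Lemma cayleyP A p :
  cayley A p <-> exists f f', A (f, f') /\ p = (f + f', f - f').
Proof.
case: p => p1 p2.
rewrite /cayley /rel_add /rel_scale /rel_inv /rel_id /=.
split=> [[_ [_ [[_ -> ->] [w [_ [v [-> Av ->]]] ->] ->]]]|].
  exists w, v; split=> //; congr pair.
  rewrite scaleN1r opprD scaler_nat mulr2n addrACA addNr add0r.
  exact: addrC.
move=> [f [f' [Af [-> ->]]]]; exists (- (f + f')), (2 *: f); split=> /=.
- by exists (f + f') => //=; rewrite scaleN1r.
- by exists f => //; exists f, f'.
- by rewrite opprD scaler_nat mulr2n addrACA addNr add0r [- f' + f]addrC.
Qed.

(** Exchanging [f] and [f'] keeps [f + f'] and changes the sign of [f - f']. *)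
Lemma cayley_inv A : cayley (rel_inv A) = rel_scale (-1) (cayley A).
Proof.
apply/seteqP; split=> p.
  move=> /cayleyP[f [f' [/= Af ->]]]; exists (f' - f) => /=.
    by apply/cayleyP; exists f', f; rewrite addrC.
  by rewrite scaleN1r opprB.
move=> [g /cayleyP[f [f' [Af [p1 ->]]] p2]]; apply/cayleyP.
exists f', f; split=> //; case: p p1 p2 => p1 p2 /= -> ->.
by rewrite scaleN1r opprB addrC.
Qed.

(** A pair [(f, f')] of the represented relation gives [(2 f, f + f')] on the left; the factor
    [half] compensates the 2. *)
Lemma rel_inv_one_plus_cayley D t : form_on D t ->
  rel_inv (rel_add (rel_id H) (cayley (rel_of_form dot D t))) =
  rel_of_form dot D (fun f g => half * one_plus dot t f g).
Proof.
move=> tD; have sD : lin_subspace D by case: tD.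
rewrite /rel_add /rel_id /rel_inv.
apply/seteqP; split=> [[p1 p2]|[p1 p2] [/= Dp hp]] /=.
  move=> [_ [_ [-> /cayleyP[f [f' [[/= Df hf] [-> ->]]]] ->]]].
  have -> : f + f' + (f - f') = 2 *: f.
    by rewrite addrACA subrr addr0 scaler_nat mulr2n.
  split=> /= [|g Dg]; first exact: lin_subspaceZ.
  rewrite /one_plus (form_onZl _ tD) // linearZl_LR /= linearDl /= hf //.
  by rewrite -mulrDr mulrA halfE mulVf ?mul1r // pnatr_eq0.
exists p2, (p1 - p2); split=> //=; last by rewrite addrC subrK.
apply/cayleyP; exists (half *: p1), (p2 - half *: p1); split.
  split=> /= [|g Dg]; first exact: lin_subspaceZ.
  rewrite linearBl /= hp // (form_onZl _ tD) // /one_plus linearZl_LR /=.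
  by rewrite mulrDr addrAC subrr add0r.
congr pair; first by rewrite addrC subrK.
by rewrite opprB addrA half_half.
Qed.

Lemma rel_scale_harmonic C : lin_subspace C ->
  rel_scale 2 (rel_inv C) = rel_inv (rel_scale 2^-1 C).
Proof.
move=> sC; apply/seteqP; split=> [[p1 p2] [f' /= Cf ->]|[p1 p2] [h /= Ch ->]].
  exists (2 *: p1); last by rewrite /= scalerA mulVf ?scale1r ?pnatr_eq0.
  by have := lin_subspaceZ 2 sC Cf.
exists (2^-1 *: p2); last by rewrite -halfE half2.
by have := lin_subspaceZ 2^-1 sC Ch.
Qed.

Lemma cayley_form_sum A B :
  nonneg_selfadjoint dot A -> nonneg_selfadjoint dot B ->
  cayley (rel_scale 2^-1 (form_sum dot A B)) =
  rel_add (harmonic_mean dot (rel_add (rel_id H) (cayley A))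
                             (rel_add (rel_id H) (cayley B)))
          (rel_scale (-1) (rel_id H)).
Proof.
move=> nA nB.
have cA := closed_oper_form norm_dot nA.
have cB := closed_oper_form norm_dot nB.
rewrite (oper_formE norm_dot nA) (oper_formE norm_dot nB).
move: cA cB; move: (form_dom dot A) (oper_form dot A) => D1 t1.
move: (form_dom dot B) (oper_form dot B) => D2 t2 c1 c2.
have h0 : 0 < 2^-1 :> R by rewrite invr_gt0.
have [t1D _] := c1; have [t2D _] := c2.
rewrite /harmonic_mean /parallel_sum !rel_inv_one_plus_cayley //.
rewrite !form_sum_rel_of_form //; try exact: closed_form_one_plus.
have hs f g : half * one_plus dot t1 f g + half * one_plus dot t2 f g =
    dot f g + half * (t1 f g + t2 f g).
  rewrite /one_plus -mulrDr addrACA mulrDr; congr (_ + _).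
  by rewrite -mulr2n -mulr_natl mulrA halfE mulVf ?mul1r // pnatr_eq0.
rewrite /rel_add /rel_id /rel_inv /rel_scale.
apply/seteqP; split=> [[p1 p2] /cayleyP[f [_ [[f' /= [Df hf] ->] [-> ->]]]]|].
  (* The pair [(f, f + f'/2)] lies in the relation of [1 + (t1 + t2)/2]; inverting, doubling and
     subtracting the identity yields [(f + f'/2, f - f'/2)]. *)
  exists (2 *: f), (- (f + 2^-1 *: f')); split=> /=.
  - exists f => //; split=> //= g Dg.
    by rewrite hs linearDl /= linearZl_LR /= hf // halfE.
  - by exists (f + 2^-1 *: f') => //=; rewrite scaleN1r.
  - by rewrite opprD scaler_nat mulr2n addrA addrK.
move=> [p1 p2] /= [_ [_ [[f [/= Df hf] ->] [_ -> ->] ->]]].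
apply/cayleyP; exists f, (p1 - f); split.
  exists (2 *: (p1 - f)); last by rewrite -halfE scalerA mulrC -scalerA half2.
  split=> //= g Dg.
  rewrite linearZl_LR /= linearBl /= hf // hs addrAC subrr add0r.
  by rewrite mulrA halfE divff ?mul1r // pnatr_eq0.
congr pair; first by rewrite addrC subrK.
by rewrite scaleN1r opprB addrA scaler_nat mulr2n.
Qed.

Lemma nonneg_selfadjoint_inv A :
  nonneg_selfadjoint dot A -> nonneg_selfadjoint dot (rel_inv A).
Proof.
move=> nA; have [_ AE A0] := nA.
apply: (nonneg_selfadjointI norm_dot) => [|p Ap]; last first.
  by rewrite dotC conj_ge0; exact: (A0 _ Ap).
apply/seteqP; split=> [p Ap|[f f'] [_ _ /= h]].
  by split=> // q Aq; apply/esym; exact: (nsa_sym nA Aq Ap).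
rewrite /rel_inv /= AE; split=> // -[g g'] Ag /=.
exact/esym/(h (g', g)).
Qed.

(** The first identity applied to the inverses: [I - T_A] is [I] plus the transform of [A^-1], and
    the harmonic mean is the inverse of half their form sum, so its transform is minus the one
    computed there. *)
Lemma cayley_harmonic_mean A B :
  nonneg_selfadjoint dot A -> nonneg_selfadjoint dot B ->
  cayley (harmonic_mean dot A B) =
  rel_add (rel_id H) (rel_scale (-1)
    (harmonic_mean dot (rel_add (rel_id H) (rel_scale (-1) (cayley A)))
                       (rel_add (rel_id H) (rel_scale (-1) (cayley B))))).
Proof.
move=> /nonneg_selfadjoint_inv nA /nonneg_selfadjoint_inv nB.
rewrite -!cayley_inv [X in cayley X]/harmonic_mean /parallel_sum.
(* Linearity lets the scalar 2 pass through the inverse. *)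
have sC : lin_subspace (form_sum dot (rel_inv A) (rel_inv B)).
  have cA := closed_oper_form norm_dot nA.
  have cB := closed_oper_form norm_dot nB.
  rewrite (oper_formE norm_dot nA) (oper_formE norm_dot nB).
  rewrite form_sum_rel_of_form //.
  have c := closed_formD norm_dot cA cB.
  exact: nsa_lin_subspace (rel_of_form_nsa norm_dot c).
rewrite rel_scale_harmonic // cayley_inv cayley_form_sum //.
move: (harmonic_mean _ _ _) => C; rewrite /rel_add /rel_id /rel_scale.
apply/seteqP; split=> -[p1 p2] /=.
  move=> [_ [f [_ [Cf [_ -> ->] ->]]] ->].
  exists p1, (- f); split=> //=; first by exists f => //; rewrite scaleN1r.
  by rewrite !scaleN1r opprB.
move=> [_ [_ [-> [f Cf ->] ->]]].
exists (f - p1); last by rewrite !scaleN1r opprB.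
exists f, (- p1); split=> //=; by exists p1 => //=; rewrite scaleN1r.
Qed.

End RelationAlgebra.

(* The complex Hilbert space is a complete normed space H over R[i] whose norm
   is induced by the inner product dot, linear in its first argument. *)
Theorem theorem5p2 (R : realType) (H : completeNormedModType R[i])
    (dot : {dot H for Num.conj})
    (norm_dot : forall f : H, `|f| ^+ 2 = dot f f)
    (A B : set (H * H))
    (hA : nonneg_selfadjoint dot A) (hB : nonneg_selfadjoint dot B) :
  let I := rel_id H in
  let TA := cayley A in
  let TB := cayley B in
  cayley (rel_scale (2^-1) (form_sum dot A B)) =
    rel_add (harmonic_mean dot (rel_add I TA) (rel_add I TB))
            (rel_scale (-1) I) /\
  cayley (harmonic_mean dot A B) =
    rel_add I (rel_scale (-1)
      (harmonic_mean dot (rel_add I (rel_scale (-1) TA))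
                         (rel_add I (rel_scale (-1) TB)))).
Proof.
by split; [exact: cayley_form_sum|exact: cayley_harmonic_mean].
Qed.
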